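(* Consider the random-connection model with measurable symmetric connection function $H:X\times X\to[0,1]$ built on a point process on $X$ whose Campbell measure admits a Papangelou density. Let $n,r\ge1$ and let $x\neq y$ be two points of $X$. The moment of order $n$ of the $(r+1)$-hop count $N^{x,y}_{r+1}$ between $x$ and $y$ is given by $$ \mathbb{E}\left[\left(N^{x,y}_{r+1}\right)^n\right] =\sum_{\substack{\rho\in\Pi[n\times r]\\ \rho\wedge\pi=\hat 0}}\mathbb{E}\left[\int_{X^{|\rho|}}\prod_{l=1}^n\prod_{i=0}^r H^{1/n^\rho_{l,i}}\big(z_{\zeta^\rho(l,i)},z_{\zeta^\rho(l,i+1)}\big)\,\hat\lambda^{|\rho|}(d\mathfrak{z}_{|\rho|})\right], $$ where, for each $\rho$, $z_0=x$, $z_{|\rho|+1}=y$, $\zeta^\rho(l,0)=0$, $\zeta^\rho(l,r+1)=|\rho|+1$, and $$ n^\rho_{l,i}:=\#\big\{(p,j)\in\{1,\ldots,n\}\times\{0,\ldots,r\}\ :\ \{\zeta^\rho(l,i),\zeta^\rho(l,i+1)\}=\{\zeta^\rho(p,j),\zeta^\rho(p,j+1)\}\big\}, $$ $1\le l\le n$, $0\le i\le r$.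
   Context: $X$ is a Polish space with Borel $\sigma$-algebra $\mathcal{B}(X)$ and a $\sigma$-finite non-atomic measure $\lambda$. $\Omega^X$ is the space of locally finite configurations $\omega\subset X$ (i.e. $\#(A\cap\omega)<\infty$ for all compact $A$), with $\omega$ identified with the Radon measure $\sum_{x\in\omega}\epsilon_x$. A point process is a probability measure $P$ on $\Omega^X$ with the $\sigma$-algebra $\mathcal{F}$ generated by the vague topology. The Campbell measure is $C(A\times B)=\mathbb{E}[\int_A \mathbf{1}_B(\omega\setminus\{x\})\,\omega(dx)]$, $A\in\mathcal{B}(X)$, $B\in\mathcal{F}$. The Papangelou density $c$ is defined by $C(dx,d\omega)=c(x;\omega)\,\lambda(dx)\,P(d\omega)$ (absolute continuity is assumed). The compound Campbell density $\hat c$ is defined inductively by $\hat c(\emptyset;\omega)=1$ and $\hat c(\{x_1,\ldots,x_n,y\};\omega)=c(y;\omega)\,\hat c(\{x_1,\ldots,x_n\};\omega\cup\{y\})$, $n\ge0$. For $\mathfrak{x}_n=(x_1,\ldots,x_n)$, $\hat\lambda^n(d\mathfrak{x}_n)=\hat c(\{x_1,\ldots,x_n\};\omega)\,\lambda(dx_1)\cdots\lambda(dx_n)$ is a random measure on $X^n$. Random-connection model: the vertex set is $\omega\cup\{x,y\}$; given $\omega$, each unordered pair of distinct vertices $\{a,b\}$ is joined by an edge (written $a\leftrightarrow b$) with probability $H(a,b)$, independently over distinct pairs. The $(r+1)$-hop count $N^{x,y}_{r+1}$ is the number of sequences $(z_1,\ldots,z_r)$ of pairwise distinct points of $\omega$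 such that $z_i\leftrightarrow z_{i+1}$ for all $i=0,\ldots,r$, with $z_0:=x$, $z_{r+1}:=y$. $\mathbb{E}$ denotes expectation over both $\omega$ and the edges. $\Pi[n\times r]$ is the set of all partitions of $\Delta_{n\times r}=\{1,\ldots,n\}\times\{1,\ldots,r\}$, and $\pi\in\Pi[n\times r]$ is the partition with blocks $\pi_k=\{(k,1),\ldots,(k,r)\}$, $k=1,\ldots,n$. For $\rho=\{\rho_1,\ldots,\rho_m\}$, $|\rho|=m$ is the number of blocks, and $\zeta^\rho(k,l)=p$ if and only if $(k,l)\in\rho_p$, for $1\le k\le n$, $1\le l\le r$. The condition $\rho\wedge\pi=\hat 0$ ($\hat 0$ being the partition into singletons) means $|\pi_k\cap\rho_l|\le1$ for all $k,l$. $H^{1/m}$ denotes the $1/m$-th power of $H$. *)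

(* Defs.v *)
From HB Require Import structures.
From mathcomp Require Import all_boot all_order all_algebra.
From mathcomp Require Import all_classical all_reals all_analysis measurable_realfun.
Set Implicit Arguments.
Unset Strict Implicit.
Unset Printing Implicit Defensive.
Import Order.TTheory GRing.Theory Num.Theory.
Local Open Scope ring_scope.

Section partitions.
Variables n r : nat.
Local Open Scope set_scope.

Definition grid_row (k : 'I_n) : {set 'I_n * 'I_r} := [set q | q.1 == k].

(* rho /\ pi = 0 *)
Definition transverse (rho : {set {set 'I_n * 'I_r}}) : bool :=
  [forall k, forall B in rho, #|grid_row k :&: B| <= 1]%N.

Variable rho : {set {set 'I_n * 'I_r}}.

(* The blocks are labelled 1, ..., #|rho| in the order of [enum rho].  Rows are
   indexed from 0 (k : 'I_n), columns by i = 0, ..., r + 1; the grid point in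
   column i, with 1 <= i <= r, has second component i - 1 : 'I_r. *)
Definition zeta (k : 'I_n) (i : nat) : 'I_#|rho|.+2 :=
  if i is j.+1 then
    if insub j is Some j' then inord (index (finset.pblock rho (k, j')) (enum rho)).+1
    else ord_max
  else ord0.

Definition edge_mult (l : 'I_n) (i : 'I_r.+1) : nat :=
  #|[set q : 'I_n * 'I_r.+1 |
      [set zeta l i; zeta l i.+1] == [set zeta q.1 q.2; zeta q.1 q.2.+1]]|.

End partitions.

Local Open Scope classical_set_scope.

(* z_0 = x, z_1, ..., z_m, z_{m+1} = y *)
Definition with_ends {T : Type} (x y : T) (z : seq T) (i : nat) : T :=
  nth x (x :: rcons z y) i.

(* To be used on a type whose uniform structure is complete. *)
Definition polish (X : topologicalType) : Prop :=
  hausdorff_space X /\ exists2 D : set X, countable D & dense D.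

Definition borel (X : ptopologicalType) : Type := g_sigma_algebraType (@open X).
HB.instance Definition _ (X : ptopologicalType) :=
  Measurable.on (borel X).

Definition non_atomic d (T : measurableType d) (R : realType)
    (mu : set T -> \bar R) : Prop :=
  forall A, measurable A -> (0 < mu A)%E ->
    exists B, [/\ measurable B, B `<=` A & (0 < mu B < mu A)%E].

Section configurations.
Variable X : ptopologicalType.

Definition locally_finite (w : set X) : Prop :=
  forall K, compact K -> finite_set (K `&` w).

Record config := Config {
  config_set :> set X;
  config_locally_finite : locally_finite config_set }.

HB.instance Definition _ := gen_eqMixin config.
HB.instance Definition _ := gen_choiceMixin config.

Lemma locally_finite0 : locally_finite set0.
Proof. by move=> K _; rewrite setI0. Qed.

HB.instance Definition _ := isPointed.Build config (Config locally_finite0).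

Lemma locally_finite_add (w : config) (y : X) :
  locally_finite (config_set w `|` [set y]).
Proof.
move=> K cK; rewrite setIUr finite_setU; split.
  exact: config_locally_finite.
by apply: sub_finite_set (finite_set1 y) => z [].
Qed.

Lemma locally_finite_remove (w : config) (y : X) :
  locally_finite (config_set w `\ y).
Proof.
move=> K cK; apply: sub_finite_set (config_locally_finite w cK).
by move=> z [Kz [wz _]].
Qed.

Definition add_pt (w : config) (y : X) : config := Config (locally_finite_add w y).
Definition remove_pt (w : config) (y : X) : config :=
  Config (locally_finite_remove w y).

(* The events {omega : omega(A) = k}, for A Borel and k in nat. *)
Definition count_events : set (set config) :=
  [set E | exists A : set (borel X), measurable A /\
     exists k : nat, E = [set w : config | (A `&` config_set w #= `I_k)%card]].

HB.instance Definition _ := @isMeasurable.Build (sigma_display count_events)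
  config <<s count_events >> (@sigma_algebra0 _ setT count_events)
  (@sigma_algebraC _ count_events) (@sigma_algebra_bigcup _ setT count_events).

End configurations.

Section point_process.
Local Open Scope ereal_scope.
Variables (R : realType) (X : ptopologicalType).

(* On rectangles this is C(A * B) = E[\int_A 1_B(omega \ {x}) omega(dx)]. *)
Definition campbell (P : probability (config X) R)
    (S : set (borel X * config X)) : \bar R :=
  \int[P]_w \esum_(x in config_set w) (\1_S (x : borel X, remove_pt w x))%:E.

Definition papangelou_density (lambda : set (borel X) -> \bar R)
    (P : probability (config X) R) (c : borel X * config X -> \bar R) : Prop :=
  [/\ measurable_fun setT c, (forall p, 0 <= c p) &
      forall S, measurable S ->
        campbell P S = \int[lambda \x P]_(p in S) c p].

Variable c : borel X * config X -> \bar R.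

Definition compound_density (s : seq X) : config X -> \bar R :=
  foldl (fun h y w => c (y, w) * h (add_pt w y)) (cst 1) s.

Lemma compound_density_nil w : compound_density [::] w = 1.
Proof. by []. Qed.

Lemma compound_density_rcons s y w :
  compound_density (rcons s y) w = c (y, w) * compound_density s (add_pt w y).
Proof. by rewrite /compound_density foldl_rcons. Qed.

Fixpoint iterated_integral (lambda : set (borel X) -> \bar R) (m : nat)
    (f : seq X -> \bar R) : \bar R :=
  if m is m'.+1 then
    \int[lambda]_z iterated_integral lambda m' (fun s => f ((z : X) :: s))
  else f [::].

(* The integral of f against the random measure \hat\lambda^m at omega = w. *)
Definition compound_integral (lambda : set (borel X) -> \bar R) (w : config X)
    (m : nat) (f : seq X -> \bar R) : \bar R :=
  iterated_integral lambda m (fun z => f z * compound_density z w).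

End point_process.

Section random_connection.
Variables (R : realType) (X : ptopologicalType).
Variables (d : measure_display) (G : measurableType d).

(* [edge a b] is the event a <-> b.  Mutual independence of the edges is the
   product rule over every finite family of distinct unordered pairs. *)
Record random_connection (H : X -> X -> R) (V : set X) (Q : probability G R)
    (edge : X -> X -> set G) : Prop := RandomConnection {
  edge_sym : forall a b, edge a b = edge b a;
  edge_measurable : forall a b, V a -> V b -> a <> b -> measurable (edge a b);
  edge_independent : forall (k : nat) (a b : 'I_k -> X),
    (forall i, [/\ V (a i), V (b i) & a i <> b i]) ->
    (forall i j, i != j -> [set a i; b i] <> [set a j; b j]) ->
    Q (\bigcap_i edge (a i) (b i)) = (\prod_i H (a i) (b i))%:E }.

Definition hop_paths (r : nat) (x y : X) (w : config X)
    (edge : X -> X -> set G) (g : G) : set (r.-tuple X) :=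
  [set z : r.-tuple X | [/\ uniq z, (forall i, config_set w (tnth z i)) &
    forall i, (i <= r)%N ->
      let a := with_ends x y z i in
      let b := with_ends x y z i.+1 in
      a <> b /\ edge a b g]].

Definition hop_count (r : nat) (x y : X) (w : config X)
    (edge : X -> X -> set G) (g : G) : \bar R :=
  counting (hop_paths x y w edge g : set (r.-tuple X)).

End random_connection.

(* Main.v *)
From HB Require Import structures.
Require Import Defs.
From mathcomp Require Import all_boot all_order all_algebra finmap.
From mathcomp Require Import all_classical all_reals all_analysis measurable_realfun.
Import Order.TTheory GRing.Theory Num.Theory.
Import HBNNSimple.
Local Open Scope classical_set_scope.
Local Open Scope ring_scope.
Local Open Scope ereal_scope.
Local Open Scope card_scope.
Set Implicit Arguments.
Unset Strict Implicit.
Unset Printing Implicit Defensive.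

(** The [n]-th power of the hop count is a sum over [n]-tuples of simple paths
    through the configuration [w] ([hop_count_esum], [esum_power]).  Such a tuple
    is an array of points of [w], indexed by the [n] by [r] grid, whose rows are
    injective.  The positions carrying equal points form the blocks of a partition
    [rho] of the grid, each of which meets every row at most once, and the array is
    recovered from [rho] together with the list of the [#|rho|] distinct
    points sitting on the blocks ([spread_bij], [esum_simple_paths]).

    Given [w], the probability that all the edges used by the paths are present is
    the product of [H] over the distinct unordered pairs among them.  Giving each
    of the occurrences of a pair the power 1 over their number turns this into a
    product over all the steps of all the paths ([probability_edges],
    [hop_count_moment]).  The multiplicities can be read off from [rho] because
    the points on the blocks are distinct and differ from [x] and [y], so that
    equal pairs of points mean equal pairs of labels ([edge_mult_spread]).  That
    neither [x] nor [y] belongs to [w] holds almost surely, because [lambda] has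
    no atom ([fixed_point_null]).

    What remains is to take the expectation of a sum over [m] distinct points of
    [w].  For [m = 1] this is the definition of the Papangelou density, extended
    from indicators to functions ([campbell_integral]); the general case,
    [georgii_nguyen_zessin], follows by induction, removing one point of [w] at a
    time.

    When the space is not locally compact, a configuration may have infinitely many
    points in every ball, and sums over it are not evidently measurable.  The remedy is a measurable enumeration.  A locally finite set has
    no accumulation point, hence each of its points is the only one in some member
    [B j] of a countable base; the point isolated by [B j] depends measurably on
    the configuration, and keeping it only for the least such [j] lists every
    point once ([esum_atoms]). *)

(** * Isolating base sets in a Polish space *)

(** The base consists of the interiors of the balls of radius [k.+1%:R^-1] around
    the points of a dense sequence; a ball itself may fail to be open. *)
Lemma dense_countable_base (R : realType) (X : pseudoPMetricType R) :
  (exists2 D : set X, countable D & dense D) ->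
  exists B : nat -> set X, (forall j, open (B j)) /\
    forall x U, nbhs x U -> exists j, B j x /\ B j `<=` U.
Proof.
move=> [D cD dD].
have [d Dd] : exists d : nat -> X, D `<=` range d.
  have D0 : D !=set0.
    by have [z [_ Dz]] := dD setT (ex_intro _ point I) openT; exists z.
  move: cD => /pfcard_geP[D00|[f]]; first by rewrite D00 in D0; case: D0.
  by exists f => z Dz; have [k _ <-] := @surj _ _ _ _ f z Dz; exists k.
pose B j := if choice.unpickle j is Some ik
  then interior (ball (d ik.1) (ik.2.+1%:R^-1 : R)) else set0.
exists B; split=> [j|x U /nbhs_ballP[e /= e0 eU]].
  rewrite /B; case: choice.unpickle => [ik|]; [exact: open_interior|exact: open0].
(* A ball of radius r around a center at distance less than r / 2 from x
   contains x in its interior and stays in the ball of radius 3 r / 2 < e. *)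
have [k ke] : exists k, (k.+1%:R^-1 < e / 2)%R.
  have e20 : (0 < e / 2)%R by rewrite divr_gt0.
  have [N _ NP] := near_infty_natSinv_lt (PosNum e20).
  by exists N; exact: (NP N (leqnn _)).
set r := (k.+1%:R^-1 : R)%R in ke *.
have r0 : (0 < r)%R by rewrite invr_gt0.
have r20 : (0 < r / 2)%R by rewrite divr_gt0.
have [z [xz Dz]] : interior (ball x (r / 2)%R) `&` D !=set0.
  by apply: dD; [exists x; exact: nbhsx_ballx|exact: open_interior].
have [i _ diz] := Dd z Dz; move/interior_subset in xz.
exists (choice.pickle (i, k)); rewrite /B choice.pickleK/= diz -/r; split.
  apply/nbhs_ballP; exists (r / 2)%R => //= t xt.
  by rewrite [r]splitr; apply: ball_triangle xt; exact: ball_sym.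
move=> t /interior_subset zt; apply: eU => /=.
apply: (@le_ball _ _ x (r / 2 + r)%R); last exact: ball_triangle zt.
rewrite [leRHS]splitr lerD ?(ltW ke)//; apply: le_trans (ltW ke).
by rewrite ler_pdivrMr// ler_peMr// ?(ltW r0)// ler1n.
Qed.

(** A filter that does not cluster at the limit [x] avoids a neighbourhood of [x],
    hence lives on finitely many terms of the sequence. *)
Lemma compact_cvg_range (R : realType) (X : pseudoMetricType R) (u : nat -> X)
    (x : X) :
  (forall k, ball x (k.+1%:R^-1 : R)%R (u k)) -> compact (x |` range u).
Proof.
move=> ux F PF FK.
have [|xF] := pselect (cluster F x); first by exists x; split => //; left.
have [A [B [FA xB AB]]] : exists A B, [/\ F A, nbhs x B & A `&` B = set0].
  apply: contrapT => nAB; apply: xF => A B FA xB; apply: contrapT => AB.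
  by apply: nAB; exists A, B; split => //; apply/nonemptyPn.
have [e /= e0 eB] : exists2 e : R, (0 < e)%R & ball x e `<=` B.
  by move: xB => /nbhs_ballP[e e0 eB]; exists e.
have [N _ NP] := near_infty_natSinv_lt (PosNum e0).
have FAN : F (u @` `I_N).
  apply: filterS (filterI FA FK) => z [Az [zx|[k _ ukz]]].
    exfalso; suff : (A `&` B) z by rewrite AB.
    by split => //; rewrite zx; exact: nbhs_singleton.
  exists k => //=; rewrite ltnNge; apply/negP => Nk.
  suff : (A `&` B) z by rewrite AB.
  split => //; apply: eB; rewrite -ukz; apply: le_ball (ux k).
  exact/ltW/(NP k).
have [z [[k _ ukz] Fz]] :=
  @finite_compact X _ (finite_image u (finite_II N)) F PF FAN.
by exists z; split => //; right; exists k.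
Qed.

(** A locally finite set has no accumulation point: the range of a sequence of
    its points converging to [x], together with [x], would be a compact set
    containing infinitely many of them. *)
Lemma locally_finite_isolated (R : realType) (X : pseudoPMetricType R)
    (w : set X) (x : X) :
  hausdorff_space X -> locally_finite w ->
  nbhs x [set z | w z -> z = x].
Proof.
move=> hX lw; apply: contrapT => nx.
have /choice[u uP] : forall k : nat, exists z,
    [/\ ball x (k.+1%:R^-1 : R)%R z, w z & z <> x].
  move=> k; apply: contrapT => nz; apply: nx.
  apply/nbhs_ballP; exists (k.+1%:R^-1)%R => /=; first by rewrite invr_gt0.
  by move=> z xz wz; apply: contrapT => zx; apply: nz; exists z.
have ux k : ball x (k.+1%:R^-1 : R)%R (u k) by have [] := uP k.
have fu : finite_set (range u).
  have /lw := compact_cvg_range ux.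
  apply: sub_finite_set => _ [k _ <-].
  by split; [right; exists k|have [] := uP k].
have cu : closed (range u).
  have [+ _] := @accessible_finite_set_closed X.
  by move=> /(_ (hausdorff_accessible hX) _ fu).
have /nbhs_ballP[e /= e0 eu] : nbhs x (~` range u).
  apply: open_nbhs_nbhs; split; first exact: closed_openC.
  by move=> [k _ ukx]; have [] := uP k.
have [N _ NP] := near_infty_natSinv_lt (PosNum e0).
apply: (eu (u N)); last by exists N.
by apply: le_ball (ux N); exact/ltW/(NP N (leqnn _)).
Qed.

(** Base sets from whose counts one can read both the points of a configuration
    and whether a given [x] is one of them: [x] may or may not belong to [w]. *)
Definition isolating_base (X : ptopologicalType) (B : nat -> set X) :=
  (forall j, open (B j)) /\
  forall (w : config X) x, exists j, B j x /\ forall z, B j z -> config_set w z -> z = x.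

Lemma polish_isolating_base (R : realType) (X : completePseudoMetricType R) :
  polish X -> exists B : nat -> set X, isolating_base B.
Proof.
move=> [hX /dense_countable_base[B [oB bB]]]; exists B; split => // w x.
have /bB[j [jx jw]] := @locally_finite_isolated _ X _ x hX (config_locally_finite w).
by exists j; split.
Qed.

(** * Measurable operations on configurations *)

Lemma card_setD1S (T : choiceType) (A : set T) (x : T) (k : nat) :
  A x -> (A #= `I_k.+1) <-> (A `\ x #= `I_k).
Proof.
move=> Ax; split => [Ak|Ak]; last by apply/eq_cardSP; exists x.
have fA : finite_set A by apply/finite_setP; exists k.+1.
rewrite -[A]fset_setK// -set_fsetD1; apply/card_eq_fsetP.
have := card_fset_set Ak; rewrite (cardfsD1 x) in_fset_set// mem_set// add1n.
by case.
Qed.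

Lemma config_eq (X : ptopologicalType) (v w : config X) :
  config_set v = config_set w -> v = w.
Proof.
case: v w => [v lv] [w lw] /= vw; case: _ / vw in lw *.
by congr Config; exact: Prop_irrelevance.
Qed.

Lemma add_remove_pt (X : ptopologicalType) (w : config X) (z : X) :
  config_set w z -> add_pt (remove_pt w z) z = w.
Proof. by move=> wz; apply: config_eq; rewrite /= setUC setD1K. Qed.

Section config_measurability.
Variables (X : ptopologicalType) (B : nat -> set X).
Hypothesis hB : isolating_base B.

Lemma measurable_count (A : set (borel X)) k : measurable A ->
  measurable [set w : config X | A `&` config_set w #= `I_k].
Proof. by move=> mA; apply: sub_sigma_algebra; exists A; split => //; exists k. Qed.

Lemma measurable_to_config d (T : measurableType d) (f : T -> config X) :
  (forall (A : set (borel X)) k, measurable A ->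
    measurable [set t | A `&` config_set (f t) #= `I_k]) ->
  measurable_fun setT f.
Proof.
move=> mf; apply: (measurability (count_events (X := X))) => //.
by move=> _ [_ [A [mA [k ->]]] <-]; rewrite setTI; exact: mf.
Qed.

Lemma measurable_base j : measurable (B j : set (borel X)).
Proof. by apply: sub_sigma_algebra; exact: hB.1. Qed.

Section joint.
Variables (d : measure_display) (T : measurableType d).
Variables (u : T -> borel X) (v : T -> config X).
Hypotheses (mu : measurable_fun setT u) (mv : measurable_fun setT v).

(** A point [x] lies outside [w] exactly when some base set contains [x] and
    carries no point of [w]; this is where closedness of [w] is used. *)
Lemma measurable_mem_config : measurable [set t | config_set (v t) (u t)].
Proof.
rewrite -[X in measurable X]setCK; apply: measurableC.
rewrite [X in measurable X](_ : _ = \bigcup_j (u @^-1` B j `&`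
    v @^-1` [set w : config X | B j `&` config_set w #= `I_0])).
  apply: bigcup_measurable => j _; apply: measurableI.
    by rewrite -[X in measurable X]setTI; apply: mu => //; exact: measurable_base.
  rewrite -[X in measurable X]setTI; apply: mv => //.
  by apply: measurable_count; exact: measurable_base.
apply/seteqP; split => t /=.
  move=> nvu; have [j [Bju jv]] := hB.2 (v t) (u t).
  exists j => //; split => //=; rewrite II0 card_eq0; apply/eqP.
  by rewrite -subset0 => z [/jv] + vz => /(_ vz) zu; apply: nvu; rewrite -zu.
move=> [j _ [/= Bju]]; rewrite II0 card_eq0 => /eqP Bjv vu.
suff : (B j `&` config_set (v t)) (u t) by rewrite Bjv.
by split.
Qed.

Let measurable_pre (S : set (config X)) : measurable S -> measurable (v @^-1` S).
Proof. by move=> mS; rewrite -[X in measurable X]setTI; exact: mv. Qed.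

Let measurable_upre (S : set (borel X)) : measurable S -> measurable (u @^-1` S).
Proof. by move=> mS; rewrite -[X in measurable X]setTI; exact: mu. Qed.

(** Removing [u] lowers the count of [A] by one when [u] is a point of the
    configuration in [A], and changes no count otherwise. *)
Lemma measurable_remove_pt :
  measurable_fun setT (fun t => remove_pt (v t) (u t)).
Proof.
apply: measurable_to_config => A k mA.
pose M := [set t | config_set (v t) (u t)] `&` u @^-1` A.
have mM : measurable M.
  by apply: measurableI; [exact: measurable_mem_config|exact: measurable_upre].
rewrite [X in measurable X](_ : _ =
    M `&` v @^-1` [set w | A `&` config_set w #= `I_k.+1] `|`
    ~` M `&` v @^-1` [set w | A `&` config_set w #= `I_k]).
  apply: measurableU; apply: measurableI => //; first 1 last.
  - exact: measurableC.
  - by apply: measurable_pre; exact: measurable_count.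
  - by apply: measurable_pre; exact: measurable_count.
have eM t : M t -> A `&` config_set (remove_pt (v t) (u t)) =
    (A `&` config_set (v t)) `\ u t by rewrite /= setIDA.
have eN t : ~ M t -> A `&` config_set (remove_pt (v t) (u t)) =
    A `&` config_set (v t).
  move=> nM /=; apply/seteqP; split => z /=; first by move=> [? []].
  by move=> [Az vz]; split => //; split => // zu; apply: nM; rewrite /M/= -zu.
apply/seteqP; split => t /=.
  have [Mt|Mt] := pselect (M t); [left|right]; split => //=.
    by apply/(@card_setD1S _ _ (u t)); [case: Mt => ? ?; split|rewrite -eM].
  by rewrite -eN.
move=> [[Mt]|[Mt]] /=; last by rewrite -eN.
by move/(@card_setD1S _ _ (u t)) => h; rewrite [X in X #= _]eM//; apply: h; case: Mt.
Qed.

Lemma measurable_add_pt :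
  measurable_fun setT (fun t => add_pt (v t) (u t)).
Proof.
apply: measurable_to_config => A k mA.
pose M := ~` [set t | config_set (v t) (u t)] `&` u @^-1` A.
have mM : measurable M.
  apply: measurableI; last exact: measurable_upre.
  by apply: measurableC; exact: measurable_mem_config.
have eM t : M t -> (A `&` config_set (add_pt (v t) (u t))) `\ u t =
    A `&` config_set (v t).
  move=> [/= nvu Au]; apply/seteqP; split => z /=; first by move=> [[? [|]]].
  by move=> [Az vz]; split; [split => //; left|move=> zu; apply: nvu; rewrite -zu].
have eN t : ~ M t -> A `&` config_set (add_pt (v t) (u t)) =
    A `&` config_set (v t).
  move=> nM /=; apply/seteqP; split => z /=; last by move=> [? ?]; split => //; left.
  move=> [Az [vz|zu]]; split => //; apply: contrapT => nvz; apply: nM.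
  by rewrite /M/= -zu.
have uA t : M t -> (A `&` config_set (add_pt (v t) (u t))) (u t).
  by move=> [_ Au]; split => //; right.
case: k => [|k].
  rewrite [X in measurable X](_ : _ =
      ~` M `&` v @^-1` [set w | A `&` config_set w #= `I_0]).
    apply: measurableI; first exact: measurableC.
    by apply: measurable_pre; exact: measurable_count.
  apply/seteqP; split => t; last by move=> [/= Mt]; rewrite -eN.
  move=> /=; have [/uA Mt|Mt] := pselect (M t).
    by rewrite II0 card_eq0 => /eqP S0; have : set0 (u t) by rewrite -S0.
  by move=> h; split => //=; rewrite -eN.
rewrite [X in measurable X](_ : _ =
    M `&` v @^-1` [set w | A `&` config_set w #= `I_k] `|`
    ~` M `&` v @^-1` [set w | A `&` config_set w #= `I_k.+1]).
  apply: measurableU; apply: measurableI => //; first 1 last.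
  - exact: measurableC.
  - by apply: measurable_pre; exact: measurable_count.
  - by apply: measurable_pre; exact: measurable_count.
apply/seteqP; split => t /=.
  have [Mt|Mt] := pselect (M t); [left|right]; split => //=.
    by rewrite -eM//; apply/card_setD1S => //; exact: uA.
  by rewrite -eN.
move=> [[Mt]|[Mt]] /=; last by rewrite -eN.
by rewrite -eM// => h; apply/(@card_setD1S _ _ (u t)) => //; exact: uA.
Qed.

End joint.

Definition atom j : set (config X) := [set w | B j `&` config_set w #= `I_1].

(** Set to [point] outside [atom j], so as to be measurable everywhere. *)
Definition atom_pt j (w : config X) : borel X :=
  if w \in atom j then xget point (B j `&` config_set w) else point.

(** The points isolated by [B i] and [B j] coincide exactly when [B i `&` B j]
    still carries a point: repetitions are detected by counts alone. *)
Definition new_atom j : set (config X) :=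
  atom j `\` \bigcup_(i < j) (atom i `&`
    [set w : config X | (B i `&` B j) `&` config_set w #= `I_1]).

Lemma measurable_atom j : measurable (atom j).
Proof. by apply: measurable_count; exact: measurable_base. Qed.

Lemma measurable_new_atom j : measurable (new_atom j).
Proof.
apply: measurableD; first exact: measurable_atom.
apply: bigcup_measurable => i _; apply: measurableI; first exact: measurable_atom.
by apply: measurable_count; apply: measurableI; exact: measurable_base.
Qed.

Lemma atom_ptE j w : atom j w -> B j `&` config_set w = [set atom_pt j w].
Proof.
move=> jw; rewrite /atom_pt mem_set//.
have /eq_cardSP[z jz] := jw.
rewrite II0 card_eq0 => /eqP jwz.
have e : B j `&` config_set w = [set z].
  by rewrite -(setD1K jz) jwz setU0.
by rewrite e (@xget_unique _ _ _ z).
Qed.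

(** The position of the isolated point is an event about counts; this makes both
    [atom_pt] measurable and repetitions detectable. *)
Lemma atom_subset (A : set X) j w : atom j w -> A `<=` B j ->
  (A `&` config_set w #= `I_1) <-> A (atom_pt j w).
Proof.
move=> jw AB; have e := atom_ptE jw; split => [/eq_cardSP[z [Az wz] _]|Ap].
  suff -> : atom_pt j w = z by [].
  have : (B j `&` config_set w) z by split => //; exact: (AB _ Az).
  by rewrite e.
have pw : (B j `&` config_set w) (atom_pt j w) by rewrite e.
have -> : A `&` config_set w = [set atom_pt j w].
  apply/seteqP; split => [z [Az wz]|_ -> /=]; last by split => //; case: pw.
  by rewrite -e; split => //; exact: AB.
exact: card_set1.
Qed.

Lemma measurable_atom_pt j : measurable_fun setT (atom_pt j).
Proof.
move=> _ A mA; rewrite setTI.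
rewrite [X in measurable X](_ : _ =
    atom j `&` [set w : config X | (A `&` B j) `&` config_set w #= `I_1] `|`
    ~` atom j `&` [set w | A point]).
  apply: measurableU; apply: measurableI.
  - exact: measurable_atom.
  - by apply: measurable_count; apply: measurableI => //; exact: measurable_base.
  - by apply: measurableC; exact: measurable_atom.
  - have [Ap|Ap] := pselect (A point).
      by rewrite [X in measurable X](_ : _ = setT)//; apply/seteqP; split.
    by rewrite [X in measurable X](_ : _ = set0)//; apply/seteqP; split.
have inA w : atom j w -> (A `&` B j `&` config_set w #= `I_1) <-> A (atom_pt j w).
  move=> jw; split => [/(atom_subset jw (@subIsetr _ _ _))[]//|Aw].
  apply/(atom_subset jw (@subIsetr _ _ _)); split => //.
  have : (B j `&` config_set w) (atom_pt j w) by rewrite (atom_ptE jw).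
  by case.
apply/seteqP; split => w /=.
  have [jw|jw] := pselect (atom j w); first by move=> /(inA w jw) h; left.
  by rewrite /atom_pt memNset//; right.
move=> [[jw /(inA w jw)//]|[jw]].
by rewrite /atom_pt memNset.
Qed.

(** A measurable enumeration of the configuration: each point [z] is listed once,
    at the least [j] for which [B j] isolates [z]. *)
Lemma esum_atoms (R : realType) (w : config X) (f : X -> \bar R) :
  (forall z, 0 <= f z) ->
  \esum_(z in config_set w) f z =
  \sum_(0 <= j <oo) (\1_(new_atom j) w)%:E * f (atom_pt j w).
Proof.
move=> f0; rewrite (@reindex_esum _ _ _ [set j | new_atom j w] _ (atom_pt^~ w)).
  rewrite esum_mkcond nneseries_esumT; last first.
    by move=> j; rewrite mule_ge0// lee_fin.
  apply: eq_esum => j _; rewrite indicE.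
  have [jw|jw] := pselect (new_atom j w); first by rewrite !mem_set// mul1e.
  by rewrite !memNset// mul0e.
split.
- move=> j [jw _] /=.
  have : (B j `&` config_set w) (atom_pt j w) by rewrite (atom_ptE jw).
  by case.
- have no_repeat i j : new_atom i w -> new_atom j w ->
      atom_pt i w = atom_pt j w -> ~~ (i < j)%N.
    move=> [iw _] [jw nj] ij; apply/negP => ltij; apply: nj; exists i => //.
    split => //=; apply/(atom_subset jw (@subIsetr _ _ _)).
    have [+ _] : (B i `&` config_set w) (atom_pt i w) by rewrite (atom_ptE iw).
    have [+ _] : (B j `&` config_set w) (atom_pt j w) by rewrite (atom_ptE jw).
    by rewrite ij; split.
  move=> i j; rewrite !inE/= => iw jw ij; apply/eqP; rewrite eqn_leq.
  by apply/andP; split; rewrite leqNgt no_repeat.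
- move=> z wz /=.
  have ex : exists j, `[< atom j w /\ B j z >].
    have [j [jz jw]] := hB.2 w z; exists j; apply/asboolP; split => //.
    rewrite /atom/= (_ : _ `&` _ = [set z]); first exact: card_set1.
    by apply/seteqP; split => [t [/jw + wt]|_ ->//]; exact.
  case: (ex_minnP ex) => j /asboolP[jw jz] jmin.
  have atz i : atom i w -> B i z -> atom_pt i w = z.
    move=> iw iz; have : (B i `&` config_set w) z by [].
    by rewrite (atom_ptE iw) => ->.
  exists j; last exact: atz.
  split => // -[i /= ltij [iw /(atom_subset jw (@subIsetr _ _ _))[+ _]]].
  rewrite atz// => iz; have : (j <= i)%N by apply: jmin; exact/asboolP.
  by rewrite leqNgt ltij.
Qed.

End config_measurability.

(** * Campbell integrals of functions *)

Section weighted_integral.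
Variables (R : realType) (d d' : measure_display).
Variables (T : measurableType d) (T' : measurableType d').
Variables (nu : {measure set T -> \bar R}) (k : T -> \bar R) (phi : T -> T').
Hypotheses (mk : measurable_fun setT k) (k0 : forall t, 0 <= k t).
Hypothesis mphi : measurable_fun setT phi.

Let measurable_weighted (f : T' -> \bar R) : measurable_fun setT f ->
  measurable_fun setT (fun t => k t * f (phi t)).
Proof. by move=> mf; apply: emeasurable_funM => //; exact: measurableT_comp. Qed.

(** Together with [weighted_integral_lim], this computes the functional that maps
    [G] to the integral of [k * (G \o phi)] from its values on indicators. *)
Lemma weighted_integral_nnsfun (g : {nnsfun T' >-> R}) :
  \int[nu]_t (k t * (g (phi t))%:E) =
  \sum_(r \in range g) r%:E *
    \int[nu]_t (k t * (\1_(g @^-1` [set r]) (phi t))%:E).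
Proof.
have r0 r : range g r -> 0 <= r%:E by move=> [z _ <-]; rewrite lee_fin.
transitivity (\int[nu]_t (\sum_(r \in range g)
    r%:E * (k t * (\1_(g @^-1` [set r]) (phi t))%:E))).
  apply: eq_integral => t _; rewrite fimfunE -fsumEFin//= ge0_mule_fsumr.
    by apply: eq_fsbigr => r _; rewrite EFinM muleCA.
  by move=> r; exact: nnfun_muleindic_ge0.
have mI r : measurable_fun setT
    (fun t => k t * (\1_(g @^-1` [set r]) (phi t))%:E).
  apply: (measurable_weighted (f := fun z => (\1_(g @^-1` [set r]) z)%:E)).
  by apply/measurable_EFinP; exact: measurable_indic.
have I0 r t : 0 <= k t * (\1_(g @^-1` [set r]) (phi t))%:E.
  by rewrite mule_ge0// lee_fin.
rewrite ge0_integral_fsum//; last 2 first.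
- by move=> r; exact: measurable_funeM.
- move=> r t _; have [|rneg] := leP 0%R r; first by move=> ?; rewrite mule_ge0.
  by rewrite preimage_nnfun0// indicE in_set0 !mule0.
apply: eq_fsbigr => r; rewrite inE => /r0 rr.
by rewrite ge0_integralZl.
Qed.

Lemma weighted_integral_lim (G : T' -> \bar R) (mG : measurable_fun setT G) :
  (forall z, 0 <= G z) ->
  \int[nu]_t (k t * G (phi t)) =
  limn (fun n => \int[nu]_t (k t * (nnsfun_approx measurableT mG n (phi t))%:E)).
Proof.
move=> G0; set g := nnsfun_approx measurableT mG.
rewrite -monotone_convergence//=.
- apply: eq_integral => t _; apply/esym/cvg_lim => //.
  have [->|k_neq0] := eqVneq (k t) 0.
    by rewrite mul0e; under eq_fun do rewrite mul0e; exact: cvg_cst.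
  have [G_eq0|G_neq0] := eqVneq (G (phi t)) 0.
    rewrite G_eq0 mule0; apply: cvg_near_cst; apply: nearW => n.
    suff -> : (g n (phi t))%:E = 0 by rewrite mule0.
    apply/le_anti/andP; split; last by rewrite lee_fin.
    by rewrite -G_eq0 /g nnsfun_approxE; exact: le_approx.
  apply: cvgeM; first by rewrite mule_defE (negbTE k_neq0) (negbTE G_neq0).
    exact: cvg_cst.
  exact: cvg_nnsfun_approx.
- move=> n; apply: (measurable_weighted (f := fun z => (g n z)%:E)).
  exact/measurable_EFinP.
- by move=> n t _; rewrite mule_ge0// lee_fin.
- move=> t _ a b ab; rewrite lee_wpmul2l// lee_fin.
  exact/lefP/nd_nnsfun_approx.
Qed.

End weighted_integral.

(** The two integrals may live on different spaces: only their values on the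
    indicators of the common target [T'] matter. *)
Lemma eq_weighted_integral (R : realType) d1 d2 d'
    (T1 : measurableType d1) (T2 : measurableType d2) (T' : measurableType d')
    (nu1 : {measure set T1 -> \bar R}) (nu2 : {measure set T2 -> \bar R})
    (k1 : T1 -> \bar R) (k2 : T2 -> \bar R) (phi1 : T1 -> T') (phi2 : T2 -> T') :
  measurable_fun setT k1 -> (forall t, 0 <= k1 t) -> measurable_fun setT phi1 ->
  measurable_fun setT k2 -> (forall t, 0 <= k2 t) -> measurable_fun setT phi2 ->
  (forall S, measurable S -> \int[nu1]_t (k1 t * (\1_S (phi1 t))%:E) =
                             \int[nu2]_t (k2 t * (\1_S (phi2 t))%:E)) ->
  forall G : T' -> \bar R, measurable_fun setT G -> (forall z, 0 <= G z) ->
  \int[nu1]_t (k1 t * G (phi1 t)) = \int[nu2]_t (k2 t * G (phi2 t)).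
Proof.
move=> mk1 k10 mphi1 mk2 k20 mphi2 eqI G mG G0.
rewrite !(weighted_integral_lim _ _ _ _ mG)//; congr (limn _).
apply/funext => n; rewrite !weighted_integral_nnsfun//.
by apply: eq_fsbigr => r _; rewrite eqI.
Qed.

Lemma measurable_fun_prod_nat d d' (T : measurableType d) (U : measurableType d')
    (f : T * nat -> U) :
  (forall j, measurable_fun setT (fun t => f (t, j))) -> measurable_fun setT f.
Proof.
move=> mf _ A mA; rewrite setTI.
rewrite [X in measurable X](_ : _ =
    \bigcup_j (((fun t => f (t, j)) @^-1` A) `*` [set j])).
  apply: bigcup_measurable => j _; apply: measurableX => //.
  by rewrite -[X in measurable X]setTI; exact: mf.
by apply/seteqP; split => [[t j] /= Af|[t j] [i _ [/= Af ->]]]//; exists j.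
Qed.

(** Summing over the enumeration of the configuration is integrating over [nat],
    which makes the results on product measures available. *)
HB.instance Definition _ (R : realType) :=
  @Measure_isSigmaFinite.Build _ _ _ (@counting nat R) (sigma_finite_counting R).

Section mecke.
Variables (R : realType) (X : ptopologicalType) (B : nat -> set X).
Hypothesis hB : isolating_base B.
Variables (lambda : {sigma_finite_measure set (borel X) -> \bar R}).
Variables (P : probability (config X) R) (c : borel X * config X -> \bar R).
Hypothesis c_density : papangelou_density lambda P c.

Let F := new_atom B.
Let p := atom_pt B.

(** Both sides are weighted integrals transported to pairs (point, reduced
    configuration): the left one from [P \x counting] through the enumeration of
    the configuration, the right one from [lambda \x P].  They agree on
    indicators by definition of the Papangelou density. *)
Lemma campbell_integral (G : borel X * config X -> \bar R) :
  measurable_fun setT G -> (forall q, 0 <= G q) ->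
  \int[P]_w (\esum_(z in config_set w) G (z : borel X, remove_pt w z)) =
  \int[lambda \x P]_q (c q * G q).
Proof.
have [mc c0 eqC] := c_density.
pose k (wj : config X * nat) : \bar R := (\1_(F wj.2) wj.1)%:E.
pose phi (wj : config X * nat) : borel X * config X :=
  (p wj.2 wj.1, remove_pt wj.1 (p wj.2 wj.1)).
have mk : measurable_fun setT k.
  apply: measurable_fun_prod_nat => j; apply/measurable_EFinP.
  by apply: measurable_indic; exact: measurable_new_atom.
have k0 t : 0 <= k t by rewrite lee_fin.
have mphi : measurable_fun setT phi.
  apply: measurable_fun_prod_nat => j; apply/measurable_fun_pairP; split => /=.
    exact: measurable_atom_pt.
  apply: (measurable_remove_pt hB (u := p j) (v := id)) => //.
  exact: measurable_atom_pt.
have esumE (g : borel X * config X -> \bar R) :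
    measurable_fun setT g -> (forall q, 0 <= g q) ->
    \int[P]_w (\esum_(z in config_set w) g (z : borel X, remove_pt w z)) =
    \int[P \x counting]_wj (k wj * g (phi wj)).
  move=> mg g0.
  rewrite (@fubini_tonelli1 _ _ _ _ _ P counting (fun wj => k wj * g (phi wj))); last 2 first.
  - by apply: emeasurable_funM => //; exact: measurableT_comp.
  - by move=> t; rewrite mule_ge0.
  apply: eq_integral => w _; rewrite /fubini_F.
  rewrite ge0_integral_count; last by move=> j; rewrite mule_ge0.
  exact: (esum_atoms hB _ (f := fun z => g (z, remove_pt w z))).
move=> mG G0; rewrite esumE//.
rewrite (@eq_weighted_integral _ _ _ _ _ _ _ _ (lambda \x P) k c phi id)//.
move=> S mS; rewrite -(esumE (fun q => (\1_S q)%:E)) => [||q]; last 2 first.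
- exact/measurable_EFinP/measurable_indic.
- by rewrite lee_fin.
rewrite -/(campbell P S) eqC// [LHS]integral_mkcond; apply: eq_integral => q _.
rewrite patchE indicE; case: ifPn => qS; [rewrite mule1|rewrite mule0] => //.
Qed.

End mecke.

(** * The multi-point Georgii-Nguyen-Zessin formula *)

(** Joint measurability in a parameter and a list of [m] points, tested by
    composing with arbitrary measurable maps; this replaces an [m]-fold product
    space. *)
Definition seq_measurable (R : realType) (X : ptopologicalType) d
    (T : measurableType d) (m : nat) (h : T -> seq X -> \bar R) : Prop :=
  forall d' (T' : measurableType d') (tau : T' -> T) (zs : nat -> T' -> borel X),
    measurable_fun setT tau -> (forall i, measurable_fun setT (zs i)) ->
    measurable_fun setT (fun t => h (tau t) (mkseq (fun i => zs i t : X) m)).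

Section seq_measurable.
Variables (R : realType) (X : ptopologicalType).

Lemma mkseq_cons (A : Type) (f : nat -> A) m :
  mkseq f m.+1 = f 0%N :: mkseq (fun i => f i.+1) m.
Proof. by rewrite /mkseq /= -[1%N]addn0 iotaDl -map_comp. Qed.

Lemma seq_measurable_cons d (T : measurableType d) m (h : T -> seq X -> \bar R)
    d' (T' : measurableType d') (tau : T' -> T) (z : T' -> borel X) :
  seq_measurable m.+1 h -> measurable_fun setT tau -> measurable_fun setT z ->
  seq_measurable m (fun t s => h (tau t) ((z t : X) :: s)).
Proof.
move=> mh mtau mz d2 T2 tau2 zs mtau2 mzs.
have := mh d2 T2 (tau \o tau2) (fun i => if i is i'.+1 then zs i' else z \o tau2).
rewrite (_ : (fun t => _) = (fun t => h (tau (tau2 t))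
    ((z (tau2 t) : X) :: mkseq (fun i => zs i t : X) m))).
  apply; first exact: measurableT_comp.
  by case => [|i] //; exact: measurableT_comp.
by apply/funext => t; rewrite mkseq_cons.
Qed.

Lemma seq_measurable_rcons d (T : measurableType d) m (h : T -> seq X -> \bar R)
    d' (T' : measurableType d') (tau : T' -> T) (z : T' -> borel X) :
  seq_measurable m.+1 h -> measurable_fun setT tau -> measurable_fun setT z ->
  seq_measurable m (fun t s => h (tau t) (rcons s (z t : X))).
Proof.
move=> mh mtau mz d2 T2 tau2 zs mtau2 mzs.
have := mh d2 T2 (tau \o tau2) (fun i => if (i < m)%N then zs i else z \o tau2).
rewrite (_ : (fun t => _) = (fun t => h (tau (tau2 t))
    (rcons (mkseq (fun i => zs i t : X) m) (z (tau2 t) : X)))).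
  apply; first exact: measurableT_comp.
  by move=> i; case: ifP => // _; exact: measurableT_comp.
apply/funext => t; rewrite mkseqS ltnn; congr (h _ (rcons _ _)).
by apply/eq_in_map => i; rewrite mem_iota => /andP[_]; rewrite add0n => ->.
Qed.

Lemma seq_measurable_comp d (T : measurableType d) m (h : T -> seq X -> \bar R)
    d' (T' : measurableType d') (tau : T' -> T) :
  seq_measurable m h -> measurable_fun setT tau ->
  seq_measurable m (fun t => h (tau t)).
Proof.
by move=> mh mtau d2 T2 tau2 zs mtau2 mzs; apply: mh => //; exact: measurableT_comp.
Qed.

Lemma seq_measurableM d (T : measurableType d) m (h k : T -> seq X -> \bar R) :
  seq_measurable m h -> seq_measurable m k ->
  seq_measurable m (fun t s => h t s * k t s).
Proof.
by move=> mh mk d2 T2 tau2 zs mtau2 mzs; apply: emeasurable_funM; [exact: mh|exact: mk].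
Qed.

Variable lambda : {sigma_finite_measure set (borel X) -> \bar R}.
Local Notation iter := (iterated_integral lambda).

Lemma iterated_integral_ge0 m (f : seq X -> \bar R) :
  (forall s, 0 <= f s) -> 0 <= iter m f.
Proof.
by elim: m f => //= m IH f f0; apply: integral_ge0 => z _; exact: IH.
Qed.

Lemma eq_iterated_integral m (f g : seq X -> \bar R) :
  (forall s, size s = m -> f s = g s) -> iter m f = iter m g.
Proof.
elim: m f g => [|m IH] f g fg /=; first exact: fg.
by apply: eq_integral => z _; apply: IH => s sm; apply: fg; rewrite /= sm.
Qed.

Lemma measurable_iterated_integral m d (T : measurableType d)
    (h : T -> seq X -> \bar R) :
  seq_measurable m h -> (forall t s, 0 <= h t s) ->
  measurable_fun setT (fun t => iter m (h t)).
Proof.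
elim: m d T h => [|m IH] d T h mh h0 /=.
  exact: (mh _ _ id (fun _ => cst point)).
pose h' (tz : T * borel X) s := h tz.1 ((tz.2 : X) :: s).
have mh' : seq_measurable m h' by apply: seq_measurable_cons.
have := IH _ _ h' mh' (fun _ _ => h0 _ _).
move/(@measurable_fun_fubini_tonelli_F _ _ _ _ _ lambda); apply => tz.
by apply: iterated_integral_ge0 => s; exact: h0.
Qed.

Let measurable_section m d (T : measurableType d) (h : T -> seq X -> \bar R) t :
  seq_measurable m.+1 h -> (forall t s, 0 <= h t s) ->
  measurable_fun setT (fun z : borel X => iter m (fun s => h t ((z : X) :: s))).
Proof.
move=> mh h0; apply: (measurable_iterated_integral
  (h := fun (z : borel X) s => h t ((z : X) :: s))) => //.
exact: (seq_measurable_cons mh (measurable_cst t) (@measurable_id _ _ _)).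
Qed.

Lemma iterated_integralZl m d (T : measurableType d) (h : T -> seq X -> \bar R)
    t (k : \bar R) :
  seq_measurable m h -> (forall t s, 0 <= h t s) -> 0 <= k ->
  iter m (fun s => k * h t s) = k * iter m (h t).
Proof.
move=> + + k0; elim: m d T h t => [//|m IH] d T h t mh h0 /=.
rewrite -ge0_integralZl//; last 2 first.
- exact: measurable_section.
- by move=> z _; apply: iterated_integral_ge0 => s; exact: h0.
apply: eq_integral => z _.
by apply: (IH _ _ (fun (z : borel X) s => h t ((z : X) :: s))) => //;
  exact: (seq_measurable_cons mh (measurable_cst t) (@measurable_id _ _ _)).
Qed.

Lemma iterated_integral_nneseries m d (T : measurableType d)
    (h : nat -> T -> seq X -> \bar R) t :
  (forall j, seq_measurable m (h j)) -> (forall j t s, 0 <= h j t s) ->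
  iter m (fun s => \sum_(0 <= j <oo) h j t s) =
  \sum_(0 <= j <oo) iter m (h j t).
Proof.
elim: m d T h t => [//|m IH] d T h t mh h0 /=.
rewrite -integral_nneseries//; last 2 first.
- by move=> j; apply: measurable_section.
- by move=> j z _; apply: iterated_integral_ge0 => s; exact: h0.
apply: eq_integral => z _.
apply: (IH _ _ (fun j (z : borel X) s => h j t ((z : X) :: s))) => // j.
exact: (seq_measurable_cons (mh j) (measurable_cst t) (@measurable_id _ _ _)).
Qed.

(** The compound density consumes its points from the last one, whereas the
    iterated integral starts with the first: Tonelli turns one into the
    other. *)
Lemma iterated_integral_rcons m d (T : measurableType d)
    (h : T -> seq X -> \bar R) t :
  seq_measurable m.+1 h -> (forall t s, 0 <= h t s) ->
  iter m.+1 (h t) = \int[lambda]_z iter m (fun s => h t (rcons s (z : X))).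
Proof.
elim: m d T h t => [//|m IH] d T h t mh h0.
transitivity (\int[lambda]_z1 \int[lambda]_z
    iter m (fun s => h t ((z1 : X) :: rcons s (z : X)))).
  apply: eq_integral => z1 _.
  apply: (IH _ _ (fun (z : borel X) s => h t ((z : X) :: s))) => //.
  exact: (seq_measurable_cons mh (measurable_cst t) (@measurable_id _ _ _)).
pose F (zz : borel X * borel X) :=
  iter m (fun s => h t ((zz.1 : X) :: rcons s (zz.2 : X))).
apply: (@fubini_tonelli _ _ _ _ _ lambda lambda F); last first.
  by move=> zz; apply: iterated_integral_ge0 => s; exact: h0.
apply: (measurable_iterated_integral
  (h := fun (zz : borel X * borel X) s => h t ((zz.1 : X) :: rcons s (zz.2 : X)))) => //.
have mh1 := seq_measurable_cons mh (measurable_cst t) (@measurable_id _ (borel X) _).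
exact: (seq_measurable_rcons mh1 (@measurable_fst _ _ _ _) (@measurable_snd _ _ _ _)).
Qed.

End seq_measurable.

Definition distinct_seqs (X : ptopologicalType) (m : nat) (w : config X) :
    set (seq X) :=
  [set s | [/\ size s = m, uniq s & forall z, z \in s -> config_set w z]].

Lemma config_set_remove_seq (X : ptopologicalType) (w : config X) (s : seq X) :
  config_set (foldl (@remove_pt X) w s) = config_set w `\` [set` s].
Proof.
elim: s w => [|z s IH] w /=.
  by apply/seteqP; split => [t wt|t []//]; split.
rewrite IH /=; apply/seteqP; split => t /=.
  by move=> [[wt tz] ts]; split => //; rewrite inE => /orP[/eqP|].
move=> [wt]; rewrite inE => /negP; rewrite negb_or => /andP[/eqP tz /negP ts].
by split.
Qed.

Lemma esum_distinct_seqs0 (R : realType) (X : ptopologicalType) (w : config X)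
    (F : seq X -> \bar R) : 0 <= F [::] ->
  \esum_(s in distinct_seqs 0 w) F s = F [::].
Proof.
move=> F0; rewrite (_ : distinct_seqs 0 w = [set [::]]) ?esum_set1//.
by apply/seteqP; split => [s [/size0nil]|s ->].
Qed.

(** The last point of a list of distinct points ranges over what remains of [w]
    after the removal of the others. *)
Lemma esum_distinct_seqsS (R : realType) (X : ptopologicalType) m (w : config X)
    (F : seq X -> \bar R) : (forall s, 0 <= F s) ->
  \esum_(s in distinct_seqs m.+1 w) F s =
  \esum_(s in distinct_seqs m w)
    \esum_(z in config_set (foldl (@remove_pt X) w s)) F (rcons s z).
Proof.
move=> F0; rewrite esum_esum//.
apply: (@reindex_esum _ _ _ _ _ (fun sz : seq X * X => rcons sz.1 sz.2)).
split.
- move=> [s z] [/= [sm us sw]]; rewrite config_set_remove_seq => -[wz /negP zs].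
  split; rewrite ?size_rcons ?sm// ?rcons_uniq ?zs//.
  by move=> t; rewrite mem_rcons inE => /orP[/eqP->//|]; exact: sw.
- by move=> [s z] [s' z'] _ _ /= /rcons_inj.
- case/lastP => [|s z] [/=]; rewrite ?size_rcons// rcons_uniq => -[sm] /andP[zs us] sw.
  exists (s, z) => //=; split => /=.
    by split => // t ts; apply: sw; rewrite mem_rcons inE ts orbT.
  rewrite config_set_remove_seq; split; last exact/negP.
  by apply: sw; rewrite mem_rcons mem_head.
Qed.

(** The factor [k] may be infinite, as a Papangelou density may be. *)
Lemma ge0_nneseriesZl (R : realType) (k : \bar R) (f : nat -> \bar R) :
  0 <= k -> (forall j, 0 <= f j) ->
  \sum_(0 <= j <oo) (k * f j) = k * \sum_(0 <= j <oo) f j.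
Proof.
move=> k0 f0; rewrite -!ge0_integral_count//; last by move=> j; rewrite mule_ge0.
by rewrite ge0_integralZl.
Qed.

Section georgii_nguyen_zessin.
Variables (R : realType) (X : ptopologicalType) (B : nat -> set X).
Hypothesis hB : isolating_base B.
Implicit Types f : config X -> seq X -> \bar R.

(** Summing [f] over the last of [m.+1] points leaves a summand over the others. *)
Definition sum_last_pt (f : config X -> seq X -> \bar R) (w : config X)
    (s : seq X) : \bar R :=
  \esum_(z in config_set w) f (remove_pt w z) (rcons s z).

Lemma sum_last_pt_atoms f w s : (forall w s, 0 <= f w s) ->
  sum_last_pt f w s = \sum_(0 <= j <oo) (\1_(new_atom B j) w)%:E *
    f (remove_pt w (atom_pt B j w)) (rcons s (atom_pt B j w : X)).
Proof.
by move=> f0; exact: (esum_atoms hB w (f := fun z => f (remove_pt w z) (rcons s z))).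
Qed.

Lemma sum_last_pt_ge0 f w s : (forall w s, 0 <= f w s) -> 0 <= sum_last_pt f w s.
Proof. by move=> f0; exact: esum_ge0. Qed.

Let seq_measurable_term m f j : seq_measurable m.+1 f ->
  seq_measurable m (fun w s => (\1_(new_atom B j) w)%:E *
    f (remove_pt w (atom_pt B j w)) (rcons s (atom_pt B j w : X))).
Proof.
move=> mf; have mp := measurable_atom_pt hB j.
apply: (seq_measurableM (h := fun w _ => (\1_(new_atom B j) w)%:E)).
  move=> d' T' tau zs mtau mzs; apply: measurableT_comp => //.
  by apply: measurableT_comp mtau; apply: measurable_indic; exact: measurable_new_atom.
apply: seq_measurable_rcons => //.
exact: (measurable_remove_pt hB (u := atom_pt B j) (v := id)).
Qed.

Lemma seq_measurable_sum_last_pt m f : (forall w s, 0 <= f w s) ->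
  seq_measurable m.+1 f -> seq_measurable m (sum_last_pt f).
Proof.
move=> f0 mf d' T' tau zs mtau mzs.
under eq_fun do rewrite sum_last_pt_atoms//.
apply: (ge0_emeasurable_sum (P := xpredT)) => [j t _ _|j _].
  by rewrite mule_ge0// lee_fin.
exact: (seq_measurable_term j mf).
Qed.

Lemma measurable_esum_distinct_seqs m (f : config X -> seq X -> \bar R) :
  (forall w s, 0 <= f w s) -> seq_measurable m f ->
  measurable_fun setT (fun w =>
    \esum_(s in distinct_seqs m w) f (foldl (@remove_pt X) w s) s).
Proof.
elim: m f => [|m IH] f f0 mf.
  under eq_fun do rewrite esum_distinct_seqs0//.
  exact: (mf _ _ id (fun _ => cst point)).
rewrite (_ : (fun w => _) = (fun w => \esum_(s in distinct_seqs m w)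
    sum_last_pt f (foldl (@remove_pt X) w s) s)).
  by apply: IH => [w s|]; [exact: sum_last_pt_ge0|exact: seq_measurable_sum_last_pt].
apply/funext => w; rewrite esum_distinct_seqsS//.
by apply: eq_esum => s _; apply: eq_esum => z _; rewrite foldl_rcons.
Qed.

Variables (lambda : {sigma_finite_measure set (borel X) -> \bar R}).
Variables (P : probability (config X) R) (c : borel X * config X -> \bar R).
Hypothesis c_density : papangelou_density lambda P c.

Let c0 q : 0 <= c q. Proof. by have [] := c_density. Qed.

Lemma compound_density_ge0 s w : 0 <= compound_density c s w.
Proof.
by elim/last_ind: s w => [//|s z IH] w; rewrite compound_density_rcons mule_ge0.
Qed.

Lemma seq_measurable_compound_density m :
  seq_measurable m (fun w s => compound_density c s w).
Proof.
have [mc _ _] := c_density.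
elim: m => [|m IH] d' T' tau zs mtau mzs; first exact: measurable_cst.
under eq_fun do rewrite mkseqS compound_density_rcons.
apply: emeasurable_funM.
  apply: (measurableT_comp mc (g := fun t => (zs m t, tau t))).
  exact: measurable_fun_pair.
apply: (IH _ _ (fun t => add_pt (tau t) (zs m t))) => //.
exact: (measurable_add_pt hB (u := zs m)).
Qed.

(** Induction on [m].  The last point [z] enters the compound density through the
    factor [c (z, w)], so that the one-point formula replaces the integral over
    [z] by a sum over the points [z] of [w], and [w] by [w] without [z].  The
    other factor of the compound density is evaluated at [w] with [z] added,
    which becomes [w] again, and the induction hypothesis applies to the function
    obtained by summing over [z]. *)
Lemma georgii_nguyen_zessin m (f : config X -> seq X -> \bar R) :
  (forall w s, 0 <= f w s) -> seq_measurable m f ->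
  \int[P]_w compound_integral c lambda w m (f w) =
  \int[P]_w (\esum_(s in distinct_seqs m w) f (foldl (@remove_pt X) w s) s).
Proof.
elim: m f => [|m IH] f f0 mf.
  by apply: eq_integral => w _; rewrite /compound_integral/= esum_distinct_seqs0// mule1.
have mfc := seq_measurableM mf (seq_measurable_compound_density m.+1).
have fc0 w s : 0 <= f w s * compound_density c s w.
  by rewrite mule_ge0// compound_density_ge0.
pose h (q : borel X * config X) s :=
  f q.2 (rcons s (q.1 : X)) * compound_density c s (add_pt q.2 q.1).
have h0 q s : 0 <= h q s by rewrite mule_ge0// compound_density_ge0.
have mh : seq_measurable m h.
  apply: seq_measurableM; first exact: seq_measurable_rcons.
  apply: (seq_measurable_comp (seq_measurable_compound_density m)).
  exact: (measurable_add_pt hB (u := fst) (v := snd)).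
pose G q := iterated_integral lambda m (h q).
have G0 q : 0 <= G q by apply: iterated_integral_ge0 => s; exact: h0.
have mG : measurable_fun setT G by exact: measurable_iterated_integral.
have [mc _ _] := c_density.
transitivity (\int[P]_w \int[lambda]_z (c (z, w) * G (z, w))).
  apply: eq_integral => w _; rewrite /compound_integral.
  rewrite (iterated_integral_rcons lambda w mfc fc0).
  apply: eq_integral => z _; rewrite /G -iterated_integralZl//.
  apply: eq_iterated_integral => s _.
  by rewrite compound_density_rcons muleCA.
rewrite -(@fubini_tonelli2 _ _ _ _ _ lambda P (fun q => c q * G q)); last 2 first.
- exact: emeasurable_funM.
- by move=> q; rewrite mule_ge0.
rewrite -(campbell_integral hB c_density mG G0).
transitivity (\int[P]_w compound_integral c lambda w m (sum_last_pt f w)); last first.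
  rewrite IH; [|by move=> w s; exact: sum_last_pt_ge0|
    exact: seq_measurable_sum_last_pt].
  apply: eq_integral => w _; rewrite esum_distinct_seqsS//.
  by apply: eq_esum => s _; apply: eq_esum => z _; rewrite foldl_rcons.
apply: eq_integral => w _.
transitivity (\esum_(z in config_set w) iterated_integral lambda m
    (fun s => f (remove_pt w z) (rcons s z) * compound_density c s w)).
  by apply: eq_esum => z wz; apply: eq_iterated_integral => s _;
    rewrite /h/= add_remove_pt.
have mterm j := seq_measurable_term j mf.
pose k j w s := ((\1_(new_atom B j) w)%:E *
  f (remove_pt w (atom_pt B j w)) (rcons s (atom_pt B j w : X))) *
  compound_density c s w.
have k0 j w' s : 0 <= k j w' s.
  by rewrite !mule_ge0// ?compound_density_ge0// lee_fin.
have mk j : seq_measurable m (k j).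
  exact: seq_measurableM (seq_measurable_compound_density m).
transitivity (\sum_(0 <= j <oo) iterated_integral lambda m (k j w)).
  rewrite (esum_atoms hB); last first.
    move=> z; apply: iterated_integral_ge0 => s.
    by rewrite mule_ge0// compound_density_ge0.
  apply: eq_eseriesr => j _.
  rewrite -(iterated_integralZl (h := fun w s =>
    f (remove_pt w (atom_pt B j w)) (rcons s (atom_pt B j w : X)) *
      compound_density c s w) lambda w)//.
  - by apply: eq_iterated_integral => s _; rewrite /k muleA.
  - apply: seq_measurableM (seq_measurable_compound_density m).
    apply: seq_measurable_rcons => //; last exact: measurable_atom_pt.
    apply: (measurable_remove_pt hB (u := atom_pt B j) (v := id)) => //.
    exact: measurable_atom_pt.
  - by move=> w' s; rewrite mule_ge0// compound_density_ge0.
rewrite -(iterated_integral_nneseries lambda w mk k0).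
apply: eq_iterated_integral => s _.
rewrite sum_last_pt_atoms// muleC -ge0_nneseriesZl; last 2 first.
- exact: compound_density_ge0.
- by move=> j; rewrite mule_ge0.
by apply: eq_eseriesr => j _; rewrite muleC.
Qed.

End georgii_nguyen_zessin.

(** * Countable sums *)

Section countable_esum.
Variables (T : choiceType) (A : set T).
Hypothesis cA : countable A.

(** The fibers of an injection into [nat]: unlike an enumeration by [nat], they
    treat the empty set without a default point. *)
Lemma countable_fibers : exists F : nat -> set T,
  [/\ A = \bigcup_k F k, trivIset setT F &
      forall k, F k = set0 \/ exists t, F k = [set t]].
Proof.
have /countable_injP[phi phi_inj] := cA.
exists (fun k => A `&` phi @^-1` [set k]); split.
- by apply/seteqP; split => [t At|t [k _ []//]]; exists (phi t).
- by move=> i j _ _ [t [[_ /= <-] [_ /= <-]]].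
- move=> k; have [[t [At tk]]|nk] := pselect ((A `&` phi @^-1` [set k]) !=set0).
    right; exists t; apply/seteqP; split => [u [Au uk]|_ ->] //.
    by apply: phi_inj; rewrite ?inE// uk.
  by left; apply/nonemptyPn.
Qed.

Variable R : realType.

Lemma esum_countableZl (k : \bar R) (f : T -> \bar R) :
  0 <= k -> (forall t, 0 <= f t) ->
  \esum_(t in A) (k * f t) = k * \esum_(t in A) f t.
Proof.
move=> k0 f0; have [F [-> tF F1]] := countable_fibers.
rewrite !nneseries_sum_bigcup//; last by move=> t; rewrite mule_ge0.
rewrite -ge0_nneseriesZl//; last by move=> j; exact: esum_ge0.
apply: eq_eseriesr => j _; have [->|[t ->]] := F1 j.
  by rewrite !esum_set0 mule0.
by rewrite !esum_set1// mule_ge0.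
Qed.

Lemma integral_esum_countable d (G : measurableType d)
    (mu : {measure set G -> \bar R}) (f : T -> G -> \bar R) :
  (forall t, A t -> measurable_fun setT (f t)) -> (forall t g, 0 <= f t g) ->
  \int[mu]_g (\esum_(t in A) f t g) = \esum_(t in A) \int[mu]_g f t g.
Proof.
move=> + f0; have [F [-> tF F1]] := countable_fibers => mf.
rewrite nneseries_sum_bigcup//; last by move=> t; exact: integral_ge0.
under eq_integral do rewrite nneseries_sum_bigcup//.
have FE g j : \esum_(t in F j) f t g = 0 \/
    exists2 t, F j t & \esum_(t in F j) f t g = f t g.
  have [->|[t ->]] := F1 j; first by left; rewrite esum_set0.
  by right; exists t; rewrite ?esum_set1.
rewrite integral_nneseries//; last 2 first.
- move=> j; have [Fj|[t Fj]] := F1 j; rewrite Fj.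
    by under eq_fun do rewrite esum_set0; exact: measurable_cst.
  under eq_fun do rewrite esum_set1//.
  by apply: mf; exists j => //; rewrite Fj.
- by move=> j g _; exact: esum_ge0.
apply: eq_eseriesr => j _; have [->|[t ->]] := F1 j.
  rewrite esum_set0; under eq_integral do rewrite esum_set0.
  exact: integral0.
rewrite esum_set1; last exact: integral_ge0.
by under eq_integral do rewrite esum_set1//.
Qed.

End countable_esum.

Lemma counting_esum (R : realType) (T : choiceType) (A : set T) :
  counting A = \esum_(t in A) 1 :> \bar R.
Proof.
rewrite /counting; case: asboolP => finA.
  rewrite esum_fset// fsbig_finite//= card_fset_sum1.
  by rewrite natr_sum -sumEFin.
apply/esym/eqyP => r r0.
have [B BA Br] := infinite_set_fset (Num.truncn r).+1 finA.
apply: esum_ge; exists [set` B] => //.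
apply: (@le_trans _ _ (Num.truncn r).+1%:R%:E).
  by rewrite lee_fin ltW// truncnS_gt.
move: Br; rewrite -(@ler_nat R) -lee_fin => /le_trans; apply.
by rewrite fsbig_finite//= card_fset_sum1 sumEFin natr_sum// set_fsetK.
Qed.

Section esum_power.
Variables (R : realType) (T : choiceType) (A : set T).
Hypothesis cA : countable A.

Definition tuples_in n : set (n.-tuple T) := [set t | forall i, A (tnth t i)].

Let consP n (z : T) (t : n.-tuple T) :
  tuples_in [tuple of z :: t] <-> A z /\ tuples_in t.
Proof.
split=> [h|[Az At] i].
  by split=> [|i]; [have := h ord0; rewrite tnth0|have := h (lift ord0 i); rewrite tnthS].
by case: (unliftP ord0 i) => [j|] ->; rewrite ?tnthS ?tnth0.
Qed.

Let cons_bij n : set_bij (A `*` tuples_in (n := n)) (tuples_in (n := n.+1))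
  (fun zt : T * n.-tuple T => [tuple of zt.1 :: zt.2]).
Proof.
split.
- by move=> [z t] /= ?; exact/consP.
- move=> [z t] [z' t'] _ _ /= /(congr1 val) /= [-> tt'].
  by congr (_, _); exact: val_inj.
- move=> u; case/tupleP: u => z t /consP[Az At].
  by exists (z, t).
Qed.

Lemma countable_tuples_in n : countable (tuples_in (n := n)).
Proof.
elim: n => [|n IH].
  apply: (@sub_countable _ _ _ [set [tuple]]); last exact: countable1.
  by apply: subset_card_le => t _; exact: tuple0.
have [/image_subP sub _ surj] := cons_bij n.
apply: sub_countable (countableX cA IH).
exact: card_le_trans (subset_card_le surj) (card_image_le _ _).
Qed.

Lemma esum_power n (f : T -> \bar R) : (forall t, 0 <= f t) ->
  (\esum_(t in A) f t) ^+ n =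
  \esum_(s in tuples_in (n := n)) \prod_(i < n) f (tnth s i).
Proof.
move=> f0; elim: n => [|n IH].
  rewrite expe0 (_ : tuples_in (n := 0) = [set [tuple]]).
    by rewrite esum_set1// big_ord0.
  by apply/seteqP; split => t // _; [exact: tuple0|case].
rewrite expeS IH muleC -(esum_countableZl cA)//; last first.
  by apply: esum_ge0 => t _; exact: prode_ge0.
rewrite (reindex_esum _ _ _ _ (cons_bij n)).
transitivity (\esum_(z in A) \esum_(t in tuples_in (n := n))
    \prod_(i < n.+1) f (tnth [tuple of z :: t] i)); last first.
  by rewrite esum_esum// => z t _ _; exact: prode_ge0.
apply: eq_esum => z _; rewrite muleC -(esum_countableZl (countable_tuples_in n))//.
  apply: eq_esum => t _; rewrite big_ord_recl tnth0; congr (_ * _).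
  by apply: eq_bigr => i _; rewrite tnthS.
by move=> t; exact: prode_ge0.
Qed.

End esum_power.

(** * Probability of a family of edges *)

Lemma eq_set2 (T : Type) (a b c d : T) : a <> b -> [set a; b] = [set c; d] ->
  (a = c /\ b = d) \/ (a = d /\ b = c).
Proof.
move=> ab abcd.
have : [set c; d] a by rewrite -abcd; left.
have : [set c; d] b by rewrite -abcd; right.
by move=> [] bE [] aE; [case: ab; rewrite aE bE|right|left|case: ab; rewrite aE bE].
Qed.

Section independent_edges.
Variables (R : realType) (X : ptopologicalType) (H : X -> X -> R).
Hypothesis H_sym : forall a b, H a b = H b a.
Hypothesis H01 : forall a b, (0 <= H a b <= 1)%R.
Variables (V : set X) (d : measure_display) (G : measurableType d).
Variables (Q : probability G R) (edge : X -> X -> set G).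
Hypothesis rc : random_connection H V Q edge.

Variables (I : finType) (a b : I -> X).
Hypothesis abV : forall i, [/\ V (a i), V (b i) & a i <> b i].

Let e i : set X := [set a i; b i].

Let edge_e i j : e i = e j -> edge (a i) (b i) = edge (a j) (b j).
Proof.
have [_ _ abi] := abV i.
by move=> /(eq_set2 abi)[] [-> ->] //; exact: edge_sym rc _ _.
Qed.

Let H_e i j : e i = e j -> H (a i) (b i) = H (a j) (b j).
Proof.
by have [_ _ abi] := abV i; move=> /(eq_set2 abi)[] [-> ->].
Qed.

Let rep i := odflt i [pick j | `[< e j = e i >]].

Let e_rep i : e (rep i) = e i.
Proof. by rewrite /rep; case: pickP => [j /asboolP|]. Qed.

Let rep_e i j : e i = e j -> rep i = rep j.
Proof.
move=> ij; rewrite /rep ij; case: pickP => // /(_ j).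
by move/negP; case; exact/asboolP.
Qed.

(** Parallel edges are a single random edge: the probability that all the edges
    [a i, b i] are present is computed by keeping one representative of each
    unordered pair, and the power spreads its probability evenly over the
    copies. *)
Lemma probability_edges :
  Q (\bigcap_i edge (a i) (b i)) =
  (\prod_i (H (a i) (b i) `^
    (#|[pred j | `[< [set a i; b i] = [set a j; b j] >]]|%:R)^-1))%R%:E.
Proof.
pose S := [pred i | rep i == i].
have rep_S i : rep i \in S by rewrite inE; apply/eqP/rep_e; rewrite e_rep.
have -> : \bigcap_i edge (a i) (b i) =
    \bigcap_(k : 'I_#|S|) edge (a (enum_val k)) (b (enum_val k)).
  apply/seteqP; split => g Eg; first by move=> k _; exact: Eg.
  move=> i _; have := Eg (enum_rank_in (rep_S i) (rep i)) Logic.I.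
  by rewrite enum_rankK_in// (edge_e (e_rep i)).
rewrite (edge_independent rc (a := a \o enum_val) (b := b \o enum_val)); first last.
- move=> k l kl /= ekl; move/eqP: kl; apply; apply: enum_val_inj.
  have /eqP <- : rep (enum_val k) == enum_val k := enum_valP k.
  have /eqP <- : rep (enum_val l) == enum_val l := enum_valP l.
  exact: rep_e.
- by move=> k; exact: abV.
congr _%:E; rewrite -(big_enum_val (fun i => H (a i) (b i)))/=.
rewrite [RHS](partition_big rep (mem S))//=; apply: eq_bigr => s sS.
have H0 : (0 <= H (a s) (b s))%R by have /andP[] := H01 (a s) (b s).
have repP i : (rep i == s) = `[< [set a s; b s] = [set a i; b i] >].
  apply/eqP/asboolP => [is_|/rep_e <-]; last exact/eqP.
  by rewrite -/(e s) -is_ e_rep.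
set m := #|[pred j | `[< [set a s; b s] = [set a j; b j] >]]|.
transitivity (\prod_(i | rep i == s) (H (a s) (b s) `^ m%:R^-1))%R.
  rewrite prodr_const (_ : #|_| = m); last by apply: eq_card => i; exact: repP.
  rewrite -powR_mulrn ?powR_ge0// -powRrM mulVf ?powRr1//.
  rewrite pnatr_eq0 -lt0n; apply/card_gt0P; exists s.
  exact/asboolP.
apply: eq_bigr => i; rewrite repP => /asboolP si.
by rewrite (H_e si) /m si.
Qed.

End independent_edges.

(** * Grids of points and partitions *)

Section grid_labellings.
Variables (X : choiceType) (x0 : X) (n r : nat).
Local Notation grid := ('I_n * 'I_r)%type.
Implicit Types (rho : {set {set grid}}) (t : n.-tuple (r.-tuple X)) (s : seq X).

Definition grid_val t (q : grid) : X := tnth (tnth t q.1) q.2.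

Definition label rho (q : grid) : nat := index (finset.pblock rho q) (enum rho).

(** The paths obtained by placing the entries of [s] on the blocks of [rho], in
    the order in which [zeta] numbers the blocks. *)
Definition spread rho s : n.-tuple (r.-tuple X) :=
  [tuple [tuple nth x0 s (label rho (k, i)) | i < r] | k < n].

Lemma grid_val_spread rho s q : grid_val (spread rho s) q = nth x0 s (label rho q).
Proof. by case: q => k i; rewrite /grid_val /spread !tnth_mktuple. Qed.

Definition coincidence t : {set {set grid}} :=
  preim_partition (grid_val t) [set: grid]%SET.

Lemma coincidence_partition t : finset.partition (coincidence t) [set: grid]%SET.
Proof. exact: preim_partitionP. Qed.

Lemma mem_pblock_coincidence t q q' :
  (q' \in finset.pblock (coincidence t) q) = (grid_val t q == grid_val t q').
Proof.
rewrite pblock_equivalence_partition ?inE//.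
by split => // /eqP ->.
Qed.

Section partition.
Variable rho : {set {set grid}}.
Hypothesis prho : finset.partition rho [set: grid]%SET.

Let trho : finset.trivIset rho. Proof. by have /and3P[] := prho. Qed.

Let crho q : q \in finset.cover rho.
Proof. by rewrite (cover_partition prho) inE. Qed.

Lemma pblock_in q : finset.pblock rho q \in enum rho.
Proof. by rewrite mem_enum pblock_mem. Qed.

Lemma label_lt q : (label rho q < #|rho|)%N.
Proof. by rewrite cardE index_mem pblock_in. Qed.

Lemma eq_label q q' : (label rho q == label rho q') = (q' \in finset.pblock rho q).
Proof.
rewrite -eq_pblock//; apply/eqP/eqP => [lqq|qq]; last by rewrite /label qq.
by rewrite -(nth_index finset.set0 (pblock_in q)) -/(label rho q) lqq nth_index ?pblock_in.
Qed.

Lemma label_surj j : (j < #|rho|)%N -> exists q, label rho q = j.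
Proof.
rewrite cardE => jlt; have Brho : nth finset.set0 (enum rho) j \in rho.
  by rewrite -mem_enum mem_nth.
have [q qB] : exists q, q \in nth finset.set0 (enum rho) j.
  apply/set0Pn; apply: contraTneq Brho => ->.
  by have /and3P[] := prho.
by exists q; rewrite /label (def_pblock trho Brho qB) index_uniq// enum_uniq.
Qed.

Lemma spread_inj s s' : size s = #|rho| -> size s' = #|rho| ->
  spread rho s = spread rho s' -> s = s'.
Proof.
move=> sm s'm ss'; apply: (@eq_from_nth _ x0); first by rewrite sm s'm.
by rewrite sm => j /label_surj[q <-]; rewrite -!grid_val_spread ss'.
Qed.

(** Distinct entries of [s] keep distinct blocks apart. *)
Lemma coincidence_spread s : size s = #|rho| -> uniq s -> coincidence (spread rho s) = rho.
Proof.
move=> sm us; rewrite -[RHS](equivalence_partition_pblock prho).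
rewrite /coincidence /preim_partition /equivalence_partition; apply: eq_imset => q /=.
apply/setP => q'; rewrite !inE/= !grid_val_spread.
by rewrite nth_uniq ?sm ?label_lt// eq_label.
Qed.

Lemma spread_row_uniq s k : size s = #|rho| -> uniq s -> transverse rho ->
  uniq (tnth (spread rho s) k).
Proof.
move=> sm us /forallP/(_ k)/forall_inP trv; apply/tuple_uniqP => i j.
have := grid_val_spread rho s (k, i); have := grid_val_spread rho s (k, j).
rewrite /grid_val/= => -> -> /eqP; rewrite nth_uniq ?sm ?label_lt// eq_label => ij.
have /trv/card_le1_eqP/(_ (k, i) (k, j)) : finset.pblock rho (k, i) \in rho.
  by rewrite pblock_mem.
by rewrite !inE/= eqxx mem_pblock crho ij => /(_ isT isT)[].
Qed.

End partition.

(** A path which visits no point twice meets each block at most once. *)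
Lemma transverse_coincidence t : (forall k, uniq (tnth t k)) -> transverse (coincidence t).
Proof.
move=> ut; apply/forallP => k; apply/forall_inP => C Crho.
apply/card_le1_eqP => -[k1 i1] [k2 i2]; rewrite !inE/=.
move=> /andP[/eqP -> C1] /andP[/eqP -> C2]; congr (_, _).
have /tuple_uniqP := ut k; apply.
have trho : finset.trivIset (coincidence t) by have /and3P[] := coincidence_partition t.
by move: C2; rewrite -(def_pblock trho Crho C1) mem_pblock_coincidence => /eqP.
Qed.

(** The inverse of [spread].  The blocks are nonempty, so that the default [x0] is
    never used. *)
Definition block_vals t : seq X :=
  [seq if [pick q in C] is Some q then grid_val t q else x0 | C : {set grid} <- enum (coincidence t)].

Lemma size_block_vals t : size (block_vals t) = #|coincidence t|.
Proof. by rewrite size_map cardE. Qed.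

Lemma nth_block_vals t q : nth x0 (block_vals t) (label (coincidence t) q) = grid_val t q.
Proof.
rewrite (nth_map finset.set0) ?index_mem ?pblock_in ?coincidence_partition//.
rewrite nth_index ?pblock_in ?coincidence_partition//.
case: pickP => [q'|/(_ q)]; first by rewrite mem_pblock_coincidence => /eqP.
by rewrite mem_pblock_coincidence eqxx.
Qed.

Lemma spread_block_vals t : spread (coincidence t) (block_vals t) = t.
Proof.
apply: eq_from_tnth => k; apply: eq_from_tnth => i.
by have := grid_val_spread (coincidence t) (block_vals t) (k, i); rewrite nth_block_vals.
Qed.

Lemma uniq_block_vals t : uniq (block_vals t).
Proof.
apply/(uniqP x0) => i j; rewrite !inE size_block_vals => il jl.
have [q <-] := label_surj (coincidence_partition t) il.
have [q' <-] := label_surj (coincidence_partition t) jl.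
rewrite !nth_block_vals => /eqP; rewrite -mem_pblock_coincidence -eq_label ?coincidence_partition//.
by move/eqP.
Qed.

Lemma mem_block_vals t z : z \in block_vals t -> exists q, z = grid_val t q.
Proof.
move/(nthP x0) => [j]; rewrite size_block_vals => jl <-.
by have [q <-] := label_surj (coincidence_partition t) jl; exists q; rewrite nth_block_vals.
Qed.

End grid_labellings.

(** * Moments of the hop count in a given configuration *)

Section with_ends.
Variables (X : choiceType) (x y : X).
Implicit Types s : seq X.

Lemma with_ends_inj s i j : uniq (x :: rcons s y) ->
  (i <= (size s).+1)%N -> (j <= (size s).+1)%N ->
  with_ends x y s i = with_ends x y s j -> i = j.
Proof.
move=> us il jl /eqP; rewrite /with_ends nth_uniq//= ?size_rcons//.
by move/eqP.
Qed.

Lemma with_ends_in (A : set X) s i : (forall z, z \in s -> A z) ->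
  (i <= (size s).+1)%N -> (A `|` [set x; y]) (with_ends x y s i).
Proof.
move=> sA il; have : with_ends x y s i \in x :: rcons s y.
  by apply: mem_nth; rewrite /= size_rcons.
rewrite inE mem_rcons inE => /orP[/eqP ->|/orP[/eqP ->|/sA]]; last by left.
  by right; left.
by right; right.
Qed.

Lemma uniq_with_ends (A : set X) s : x <> y -> ~ A x -> ~ A y ->
  uniq s -> (forall z, z \in s -> A z) -> uniq (x :: rcons s y).
Proof.
move=> xy Ax Ay us sA; rewrite /= rcons_uniq us mem_rcons inE negb_or andbT -andbA.
apply/and3P; split; first exact/eqP.
  by apply/negP => /sA.
by apply/negP => /sA.
Qed.

Variables n r : nat.

(** [zeta] numbers the blocks from 1, because 0 and [#|rho|.+1] stand for the
    endpoints [x] and [y]. *)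
Lemma with_ends_spread (rho : {set {set 'I_n * 'I_r}}) s (k : 'I_n) i :
  finset.partition rho [set: 'I_n * 'I_r]%SET -> size s = #|rho| ->
  (i <= r.+1)%N ->
  with_ends x y (tnth (spread x rho s) k) i = with_ends x y s (zeta rho k i).
Proof.
move=> prho sm; case: i => [//|i]; rewrite ltnS /zeta => ir.
case: insubP => [j _ ji|]; last first.
  rewrite -leqNgt => ri; have -> : i = r by apply/eqP; rewrite eqn_leq ir.
  rewrite /with_ends /= !nth_rcons size_tuple ltnn eqxx.
  by rewrite sm ltnn eqxx.
rewrite inordK; last by rewrite !ltnS ltnW ?label_lt.
rewrite /with_ends /= !nth_rcons size_tuple -ji ltn_ord sm (label_lt prho).
by have := grid_val_spread x rho s (k, j); rewrite /grid_val (tnth_nth x).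
Qed.

End with_ends.

Section grid_sums.
Variables (R : realType) (X : ptopologicalType) (x : X) (n r : nat) (w : config X).

Definition simple_paths : set (r.-tuple X) :=
  [set z : r.-tuple X | uniq z /\ forall i, config_set w (tnth z i)].

Lemma spread_bij (rho : {set {set 'I_n * 'I_r}}) :
  finset.partition rho [set: 'I_n * 'I_r]%SET -> transverse rho ->
  set_bij (distinct_seqs #|rho| w)
    (tuples_in simple_paths (n := n) `&` [set t : n.-tuple (r.-tuple X) | coincidence t = rho])
    (spread x rho).
Proof.
move=> prho trv; split.
- move=> s [sm us sw]; split; last exact: coincidence_spread.
  move=> k; split; first exact: spread_row_uniq.
  move=> i; rewrite -[tnth _ _]/(grid_val (spread x rho s) (k, i)) grid_val_spread.
  by apply: sw; rewrite mem_nth// sm label_lt.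
- by move=> s s'; rewrite !inE => -[sm _ _] [s'm _ _]; exact: spread_inj.
- move=> t [tA <-]; exists (block_vals x t); last exact: spread_block_vals.
  split; [exact: size_block_vals|exact: uniq_block_vals|].
  by move=> z /mem_block_vals[q ->]; have [_] := tA q.1; exact.
Qed.

(** Each tuple of paths is counted once, in the term of its coincidence
    partition. *)
Lemma esum_simple_paths (F : n.-tuple (r.-tuple X) -> \bar R) :
  (forall t, 0 <= F t) ->
  \esum_(t in tuples_in simple_paths (n := n)) F t =
  \sum_(rho : {set {set 'I_n * 'I_r}} |
      finset.partition rho [set: 'I_n * 'I_r]%SET && transverse rho)
    \esum_(s in distinct_seqs #|rho| w) F (spread x rho s).
Proof.
move=> F0.
transitivity (\esum_(t in tuples_in simple_paths (n := n))
    \sum_(rho : {set {set 'I_n * 'I_r}} |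
        finset.partition rho [set: 'I_n * 'I_r]%SET && transverse rho)
      (if t \in [set t | coincidence t = rho] then F t else 0)).
  apply: eq_esum => t tA; rewrite (bigD1 (coincidence t))/=; last first.
    rewrite coincidence_partition; apply: transverse_coincidence => k.
    by have [] := tA k.
  rewrite mem_set// big1 ?adde0// => rho /andP[_ /eqP rhot].
  by rewrite memNset// => /= /esym.
rewrite esum_sum; last by move=> t rho _ _; case: ifP.
apply: eq_bigr => rho /andP[prho trv]; rewrite -esum_mkcondr.
exact: (reindex_esum _ _ _ _ (spread_bij prho trv)).
Qed.

End grid_sums.

(** Distinct points of a configuration are isolated by distinct base sets. *)
Lemma countable_config (X : ptopologicalType) (B : nat -> set X) (w : config X) :
  isolating_base B -> countable (config_set w).
Proof.
move=> [_ hB]; have /choice[j jP] := hB w.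
apply/countable_injP; exists j => z z'; rewrite !inE => wz wz' zz'.
have [_ jz] := jP z'; have [+ _] := jP z; rewrite zz' => /jz.
exact.
Qed.

Section hop_moment.
Variables (R : realType) (X : ptopologicalType) (H : X -> X -> R).
Hypothesis H_sym : forall a b, H a b = H b a.
Hypothesis H01 : forall a b, (0 <= H a b <= 1)%R.
Variables (x y : X) (w : config X).
Hypotheses (xy : x <> y) (wx : ~ config_set w x) (wy : ~ config_set w y).
Hypothesis cw : countable (config_set w).
Variables (d : measure_display) (G : measurableType d).
Variables (Q : probability G R) (edge : X -> X -> set G).
Hypothesis rc : random_connection H (config_set w `|` [set x; y]) Q edge.
Variables n r : nat.

Definition path_event (z : r.-tuple X) : set G :=
  \bigcap_(i : 'I_r.+1) edge (with_ends x y z i) (with_ends x y z i.+1).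

Let path_step (z : r.-tuple X) (i : 'I_r.+1) : simple_paths (r := r) w z ->
  [/\ (config_set w `|` [set x; y]) (with_ends x y z i),
      (config_set w `|` [set x; y]) (with_ends x y z i.+1) &
      with_ends x y z i <> with_ends x y z i.+1].
Proof.
move=> [uz zw]; have zw' t : t \in tval z -> config_set w t.
  by move=> /tnthP[j ->].
split.
- by apply: with_ends_in => //; rewrite size_tuple ltnW// ltnS ltnW.
- by apply: with_ends_in => //; rewrite size_tuple.
- have uxy := uniq_with_ends xy wx wy uz zw'.
  move=> /(with_ends_inj uxy); rewrite size_tuple.
  have /= i1 := ltn_ord i.
  by move=> /(_ (ltnW i1) i1) /eqP; rewrite ltn_eqF.
Qed.

Lemma hop_count_esum g : hop_count R r x y w edge g =
  \esum_(z in simple_paths (r := r) w) (\1_(path_event z) g)%:E.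
Proof.
rewrite /hop_count counting_esum.
have -> : hop_paths x y w edge g =
    simple_paths (r := r) w `&` [set z : r.-tuple X | path_event z g].
  apply/seteqP; split => z /=.
    by move=> [uz zw zE]; split => // i _; have [] := zE i (leq_ord i).
  move=> [zp zE]; have [uz zw] := zp; split => // i ir /=.
  have [_ _] := path_step (Ordinal (ir : (i < r.+1)%N)) zp.
  by split => //; exact: (zE (Ordinal (ir : (i < r.+1)%N)) Logic.I).
rewrite esum_mkcondr; apply: eq_esum => z _; rewrite indicE.
have [Eg|Eg] := pselect (path_event z g); first by rewrite !mem_set.
by rewrite !memNset.
Qed.

(** Expanding the power and integrating term by term leaves the probability that
    the edges of [n] given paths are all present. *)
Lemma hop_count_moment :
  \int[Q]_g (hop_count R r x y w edge g ^+ n) =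
  \esum_(t in tuples_in (simple_paths (r := r) w) (n := n))
    (\prod_(q : 'I_n * 'I_r.+1)
      (H (with_ends x y (tnth t q.1) q.2) (with_ends x y (tnth t q.1) q.2.+1) `^
       (#|[pred q' : 'I_n * 'I_r.+1 |
          `[< [set with_ends x y (tnth t q.1) q.2;
                   with_ends x y (tnth t q.1) q.2.+1] =
              [set with_ends x y (tnth t q'.1) q'.2;
                   with_ends x y (tnth t q'.1) q'.2.+1] >]]|%:R)^-1))%R%:E.
Proof.
have cp : countable (simple_paths (r := r) w).
  apply: sub_countable (countable_tuples_in cw r).
  by apply: subset_card_le => z [_ zw] i.
under eq_integral do rewrite hop_count_esum esum_power//.
pose E (t : n.-tuple (r.-tuple X)) := \bigcap_(q : 'I_n * 'I_r.+1)
  edge (with_ends x y (tnth t q.1) q.2) (with_ends x y (tnth t q.1) q.2.+1).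
have EE t g : \prod_(k < n) (\1_(path_event (tnth t k)) g)%:E = (\1_(E t) g)%:E.
  rewrite prodEFin; congr _%:E; rewrite [RHS]indicE.
  have [Eg|/existsNP[[k i] /not_implyP[_ Eg]]] := pselect (E t g).
    rewrite mem_set// big1// => k _; rewrite indicE mem_set// => i _.
    exact: (Eg (k, i) Logic.I).
  rewrite memNset; last by move=> /(_ (k, i) Logic.I).
  rewrite (bigD1 k)//= indicE memNset ?mul0r// => /(_ i Logic.I).
  exact: Eg.
under eq_integral do under eq_esum do rewrite EE.
have step t (q : 'I_n * 'I_r.+1) :
    tuples_in (simple_paths (r := r) w) (n := n) t ->
  [/\ (config_set w `|` [set x; y]) (with_ends x y (tnth t q.1) q.2),
      (config_set w `|` [set x; y]) (with_ends x y (tnth t q.1) q.2.+1) &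
      with_ends x y (tnth t q.1) q.2 <> with_ends x y (tnth t q.1) q.2.+1].
  by move=> tp; exact: path_step.
have mE t : tuples_in (simple_paths (r := r) w) (n := n) t -> measurable (E t).
  move=> tp; apply: fin_bigcap_measurable => // q _.
  by have [Va Vb ab] := step t q tp; exact: (edge_measurable rc).
rewrite (@integral_esum_countable _ _ (countable_tuples_in cp n) _ _ _ _
  (fun t g => (\1_(E t) g)%:E)); last 2 first.
- by move=> t /mE mEt; exact/measurable_EFinP/measurable_indic.
- by move=> t g; rewrite lee_fin.
apply: eq_esum => t tp; rewrite integral_indic ?setIT//; last exact: mE.
exact: (probability_edges H_sym H01 rc
  (a := fun q : 'I_n * 'I_r.+1 => with_ends x y (tnth t q.1) q.2)
  (b := fun q : 'I_n * 'I_r.+1 => with_ends x y (tnth t q.1) q.2.+1)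
  (fun q => step t q tp)).
Qed.

End hop_moment.

(** Equal pairs of points correspond to equal pairs of labels: on the left the
    pairs are sets of points, on the right finite sets of labels. *)
Lemma eq_set2_inj (T : finType) (X : Type) (g : T -> X) (p q p' q' : T) :
  injective g ->
  `[< [set g p; g q] = [set g p'; g q'] >] =
  ([set p; q]%SET == [set p'; q']%SET).
Proof.
move=> ginj.
have mem u a b : u \in [set a; b]%SET <-> [set g a; g b] (g u).
  rewrite finset.inE finset.in_set1; split.
    by move=> /orP[/eqP ->|]; [left|rewrite finset.in_set1 => /eqP ->; right].
  by move=> [/ginj ->|/ginj ->]; rewrite ?finset.in_set1 eqxx ?orbT.
have sub a b a' b' : [set a; b]%SET = [set a'; b']%SET ->
    [set g a; g b] `<=` [set g a'; g b'].
  by move=> e z [] ->; apply/mem; rewrite -e; apply/mem; [left|right].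
apply/asboolP/eqP => [e|e]; last by apply/seteqP; split; apply: sub.
by apply/setP => u; apply/idP/idP => /mem; [rewrite e|rewrite -e] => /mem.
Qed.

Section edge_multiplicities.
Variables (X : choiceType) (x y : X) (n r : nat).
Variable rho : {set {set 'I_n * 'I_r}}.
Hypothesis prho : finset.partition rho [set: 'I_n * 'I_r]%SET.
Variable s : seq X.
Hypotheses (sm : size s = #|rho|) (us : uniq (x :: rcons s y)).

(** The number of steps along the same edge, counted on the points and on the
    labels. *)
Lemma edge_mult_spread (q : 'I_n * 'I_r.+1) :
  #|[pred q' : 'I_n * 'I_r.+1 |
    `[< [set with_ends x y (tnth (spread x rho s) q.1) q.2;
             with_ends x y (tnth (spread x rho s) q.1) q.2.+1] =
        [set with_ends x y (tnth (spread x rho s) q'.1) q'.2;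
             with_ends x y (tnth (spread x rho s) q'.1) q'.2.+1] >]]| =
  edge_mult rho q.1 q.2.
Proof.
have ends (q' : 'I_n * 'I_r.+1) :
    with_ends x y (tnth (spread x rho s) q'.1) q'.2 =
    with_ends x y s (zeta rho q'.1 q'.2) /\
    with_ends x y (tnth (spread x rho s) q'.1) q'.2.+1 =
    with_ends x y s (zeta rho q'.1 q'.2.+1).
  by split; apply: with_ends_spread => //; exact: ltnW (ltn_ord _).
rewrite /edge_mult cardsE; apply: eq_card => q'; rewrite [LHS]inE.
have [-> ->] := ends q; have [-> ->] := ends q'.
apply: (eq_set2_inj (g := fun p : 'I_#|rho|.+2 => with_ends x y s p)).
move=> p p' /(with_ends_inj us) pp'; apply: val_inj; apply: pp'; rewrite sm.
  exact: (ltn_ord p).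
exact: (ltn_ord p').
Qed.

End edge_multiplicities.

Section connection_weight.
Variables (R : realType) (X : ptopologicalType) (H : X -> X -> R).
Variables (x y : X) (n r : nat) (rho : {set {set 'I_n * 'I_r}}).

Definition connection_weight (z : seq X) : \bar R :=
  (\prod_(l < n) \prod_(i < r.+1)
    (H (with_ends x y z (zeta rho l i)) (with_ends x y z (zeta rho l i.+1))
      `^ (edge_mult rho l i)%:R^-1)%R)%:E.

Lemma connection_weight_ge0 z : 0 <= connection_weight z.
Proof.
by rewrite lee_fin; apply: prodr_ge0 => l _; apply: prodr_ge0 => i _; exact: powR_ge0.
Qed.

Hypothesis H_measurable :
  measurable_fun [set: borel X * borel X] (fun p => H p.1 p.2).

Let measurable_with_ends d (T : measurableType d) m (zs : nat -> T -> borel X) p :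
  (p < m.+2)%N -> (forall i, measurable_fun setT (zs i)) ->
  measurable_fun setT
    (fun t => with_ends x y (mkseq (fun i => zs i t : X) m) p : borel X).
Proof.
move=> pm mzs; case: p pm => [|p] pm; first exact: measurable_cst.
rewrite /with_ends /=; have [plt|pge] := ltnP p m.
  under eq_fun do rewrite nth_rcons size_mkseq plt nth_mkseq//.
  exact: mzs.
under eq_fun do rewrite nth_rcons size_mkseq ltnNge pge /=.
have -> : p = m by apply/eqP; rewrite eqn_leq pge andbT -ltnS.
by rewrite eqxx; exact: measurable_cst.
Qed.

Lemma seq_measurable_connection_weight d (T : measurableType d) :
  seq_measurable #|rho| (fun (_ : T) => connection_weight).
Proof.
move=> d' T' tau zs _ mzs; apply/measurable_EFinP.
apply: measurable_prod => l _; apply: measurable_prod => i _.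
apply: (measurableT_comp (measurable_powR _)).
apply: (measurableT_comp H_measurable (g := fun t =>
  (with_ends x y (mkseq (fun i => zs i t : X) #|rho|) (zeta rho l i) : borel X,
   with_ends x y (mkseq (fun i => zs i t : X) #|rho|) (zeta rho l i.+1) : borel X))).
by apply: measurable_fun_pair; apply: measurable_with_ends.
Qed.

End connection_weight.

(** * Averaging over the configuration *)

(** The functions are arbitrary because the moment of the hop count given [w] is
    under control only when [x] and [y] lie outside [w].  Every simple function
    below [f] can be cut off on the null set without changing its integral. *)
Lemma ge0_integral_off_null (R : realType) d (T : measurableType d)
    (mu : {measure set T -> \bar R}) (N : set T) (f g : T -> \bar R) :
  measurable N -> mu N = 0 -> (forall t, 0 <= f t) -> (forall t, 0 <= g t) ->
  (forall t, ~ N t -> f t = g t) -> \int[mu]_t f t = \int[mu]_t g t.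
Proof.
move=> mN N0 f0 g0 fg.
suff le u v : (forall t, 0 <= u t) -> (forall t, 0 <= v t) ->
    (forall t, ~ N t -> u t = v t) -> \int[mu]_t u t <= \int[mu]_t v t.
  by apply/le_anti/andP; split; apply: le => // t /fg.
move=> u0 v0 uv; rewrite !ge0_integralTE//; apply: ub_ereal_sup => _ [h hu <-].
pose h' := proj_nnsfun h (measurableC mN).
apply: ereal_sup_ge; exists (sintegral mu h').
  exists h' => // t; rewrite /h' /= /mindic indicE.
  have [Nt|Nt] := pselect (N t); first by rewrite memNset ?mulr0//; exact.
  by rewrite mem_set// mulr1 -uv.
rewrite -!integralT_nnsfun.
suff -> : \int[mu]_t (h t)%:E = \int[mu]_t (h' t)%:E by [].
apply: ge0_ae_eq_integral => //.
- exact/measurable_EFinP.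
- exact/measurable_EFinP.
- by move=> t _; rewrite lee_fin.
- by move=> t _; rewrite lee_fin.
exists N; split => // t /= nt; apply: contrapT => Nt; apply: nt => _.
by rewrite /h'/= /mindic indicE mem_set// mulr1.
Qed.

Lemma nonatomic_set1 (R : realType) d (T : measurableType d)
    (mu : {measure set T -> \bar R}) (t : T) :
  non_atomic mu -> measurable [set t] -> mu [set t] = 0.
Proof.
move=> na mt; apply/eqP; apply: contrapT => /negP mut.
have [|A [mA /subset_set1[->|->]]] := na _ mt; first by rewrite lt0e mut measure_ge0.
  by rewrite measure0 ltxx.
by rewrite ltxx andbF.
Qed.

(** The probability that [x] belongs to the configuration is the Campbell measure
    of [[set x] `*` setT], which vanishes with [lambda [set x]]. *)
Lemma fixed_point_null (R : realType) (X : completePseudoMetricType R)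
    (B : nat -> set X) (lambda : {sigma_finite_measure set (borel X) -> \bar R})
    (P : probability (config X) R) (c : borel X * config X -> \bar R) (x : X) :
  isolating_base B -> hausdorff_space X -> non_atomic lambda ->
  papangelou_density lambda P c ->
  measurable [set w : config X | config_set w x] /\
  P [set w : config X | config_set w x] = 0.
Proof.
move=> hB hX na cP; have [mc c0 eqC] := cP.
pose N := [set w : config X | config_set w x].
have mN : measurable N.
  exact: (measurable_mem_config hB (u := cst (x : borel X)) (v := id)).
split=> //; have mx : measurable ([set x] : set (borel X)).
  rewrite -[X in measurable X]setCK; apply: measurableC.
  apply: sub_sigma_algebra; apply: closed_openC.
  exact: (accessible_closed_set1 (hausdorff_accessible hX)).
have mS : measurable ([set x] `*` setT : set (borel X * config X)).
  exact: measurableX.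
have <- : campbell P ([set x] `*` setT) = P N.
  rewrite -[N]setIT -integral_indic//; apply: eq_integral => w _.
  rewrite -[RHS](esum_set1 (t := x) (a := fun z => (\1_N w)%:E)) ?lee_fin//.
  rewrite esum_mkcond [RHS]esum_mkcond; apply: eq_esum => z _.
  rewrite !indicE; have [->|zx] := eqVneq z x.
    rewrite (mem_set (erefl x : [set x] x)) [X in _ = (X : bool)%:R%:E](_ : _ = (x \in config_set w)).
      by case: (x \in config_set w) => //; rewrite mem_set.
    by apply/idP/idP; rewrite !inE.
  rewrite (@memNset _ [set x] z); last by apply/eqP.
  by case: ifP => // _; rewrite memNset// => -[/eqP]; rewrite (negbTE zx).
rewrite eqC//; apply: null_set_integral => //.
  exact: measurable_funS mc.
have /= -> := @product_measure1E _ _ _ _ _ lambda P _ _ mx (@measurableT _ (config X)).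
by rewrite (nonatomic_set1 na)// mul0e.
Qed.

Unset Implicit Arguments.

Theorem proposition3p1 (R : realType) (X : completePseudoMetricType R)
    (X_polish : polish X)
    (lambda : {sigma_finite_measure set (borel X) -> \bar R})
    (lambda_non_atomic : non_atomic lambda)
    (P : probability (config X) R)
    (c : borel X * config X -> \bar R)
    (c_density : papangelou_density lambda P c)
    (H : X -> X -> R)
    (H_measurable : measurable_fun [set: borel X * borel X] (fun p => H p.1 p.2))
    (H_sym : forall a b, H a b = H b a)
    (H01 : forall a b, (0 <= H a b <= 1)%R)
    (n r : nat) (n_ge1 : (1 <= n)%N) (r_ge1 : (1 <= r)%N)
    (x y : X) (x_neq_y : x <> y)
    (d : measure_display) (G : measurableType d)
    (Q : config X -> probability G R) (edge : config X -> X -> X -> set G)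
    (rcm : forall w : config X,
      random_connection H (config_set w `|` [set x; y]) (Q w) (edge w)) :
  \int[P]_w \int[Q w]_g (hop_count R r x y w (edge w) g ^+ n) =
  \sum_(rho : {set {set 'I_n * 'I_r}} |
      finset.partition rho [set: 'I_n * 'I_r]%SET && transverse rho)
    \int[P]_w compound_integral c lambda w #|rho| (fun z =>
      (\prod_(l < n) \prod_(i < r.+1)
        (H (with_ends x y z (zeta rho l i)) (with_ends x y z (zeta rho l i.+1))
          `^ (edge_mult rho l i)%:R^-1)%R)%:E).
Proof.
have [B hB] := polish_isolating_base X_polish; have [hX _] := X_polish.
have [mNx Nx0] := fixed_point_null x hB hX lambda_non_atomic c_density.
have [mNy Ny0] := fixed_point_null y hB hX lambda_non_atomic c_density.
pose N := [set w : config X | config_set w x] `|` [set w : config X | config_set w y].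
pose weight (rho : {set {set 'I_n * 'I_r}}) := connection_weight H x y rho.
pose S (rho : {set {set 'I_n * 'I_r}}) (w : config X) : \bar R := \esum_(s in distinct_seqs #|rho| w) weight rho s.
have weight0 (rho : {set {set 'I_n * 'I_r}}) s : 0 <= weight rho s by exact: connection_weight_ge0.
have mweight (rho : {set {set 'I_n * 'I_r}}) : seq_measurable #|rho| (fun _ : config X => weight rho).
  exact: seq_measurable_connection_weight.
have gnz (rho : {set {set 'I_n * 'I_r}}) : \int[P]_w compound_integral c lambda w #|rho| (weight rho) =
    \int[P]_w S rho w.
  exact: (georgii_nguyen_zessin hB c_density (fun _ => weight0 rho) (mweight rho)).
(* The two integrands agree when neither x nor y is a point of w. *)
transitivity (\int[P]_w \sum_(rho : {set {set 'I_n * 'I_r}} |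
    finset.partition rho [set: 'I_n * 'I_r]%SET && transverse rho) S rho w).
  apply: (ge0_integral_off_null (N := N)).
  - exact: measurableU.
  - by apply/le_anti; rewrite measure_ge0 andbT
      (le_trans (measureU2 _ mNx mNy))// [X in X + _]Nx0 [X in _ + X]Ny0 adde0.
  - move=> w; apply: integral_ge0 => g _; apply: expe_ge0.
    by rewrite /hop_count counting_esum; exact: esum_ge0.
  - by move=> w; apply: sume_ge0 => rho _; exact: esum_ge0.
  move=> w /not_orP[wx wy]; have cw := countable_config w hB.
  rewrite (hop_count_moment H_sym H01 x_neq_y wx wy cw (rcm w)).
  rewrite (esum_simple_paths x w); last first.
    by move=> t; rewrite lee_fin; apply: prodr_ge0 => q _; exact: powR_ge0.
  apply: eq_bigr => rho /andP[prho trv]; apply: eq_esum => s [sm us sw].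
  have uxy := uniq_with_ends x_neq_y wx wy us sw.
  congr _%:E; rewrite pair_bigA; apply: eq_bigr => q _.
  rewrite (edge_mult_spread prho sm uxy).
  by rewrite !with_ends_spread// ltnW// ltnS ltnW.
under [LHS]eq_integral do rewrite -big_filter.
rewrite ge0_integral_sum//; first by rewrite big_filter; apply: eq_bigr => rho _.
- move=> rho.
  exact: (measurable_esum_distinct_seqs hB (fun _ => weight0 rho) (mweight rho)).
- by move=> rho w _; exact: esum_ge0.
Qed.
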